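(* Let $m$ be a non-zero cube-free integer, let $E$ denote the Mordell curve $Y^2=X^3-432m^2$, and let $Q$ be a non-torsion point in $E(\mathbb{Q})$. For $n\ge1$ write $nQ=\left(\frac{A_n}{B_n^2},\frac{C_n}{B_n^3}\right)$ in lowest terms, with $A_n,B_n,C_n\in\mathbb{Z}$, and let $A=(A_n)_{n\ge 1}$. Then $Z(A)\le 12$.
   Context: In lowest terms means $\gcd(A_n,B_n)=\gcd(C_n,B_n)=1$; the sign of $B_n$ is irrelevant. Primitive divisor: for a sequence $(A_n)_{n\ge1}$ of integers, an integer $d>1$ is a primitive divisor of $A_n$ if $d\mid A_n$ and $\gcd(d,A_k)=1$ for all non-zero terms $A_k$ with $k<n$. Zsigmondy bound: $Z(A)=\max\{n \mid A_n \text{ does not have a primitive divisor}\}$ if this set is finite (with $Z(A)=0$ if the set is empty), and $Z(A)=\infty$ otherwise. Thus $Z(A)\le 12$ means that $A_n$ has a primitive divisor for every $n>12$. *)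

(* Defs.v *)
From mathcomp Require Import all_boot all_order all_algebra.
From mathcomp Require Import finmap.
From mathcomp Require Import boolp classical_sets cardinality constructive_ereal.

Set Implicit Arguments.
Unset Strict Implicit.
Unset Printing Implicit Defensive.

Import Order.TTheory GRing.Theory Num.Theory.
Local Open Scope classical_set_scope.
Local Open Scope ring_scope.

Section ShortWeierstrass.
Variables (F : fieldType) (a b : F).

Inductive ecpoint : Type := ECInf | ECAff of F & F.

Definition oncurve (P : ecpoint) : Prop :=
  if P is ECAff x y then y ^+ 2 = x ^+ 3 + a * x + b else True.

(* Chord-and-tangent law on y^2 = x^3 + a x + b, total on all pairs of the
   affine plane but only meaningful on the curve, where equal abscissas force
   y2 = y1 or y2 = - y1. The case y1 = - y2 includes doubling a point with
   y = 0. *)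
Definition ecadd (P Q : ecpoint) : ecpoint :=
  match P, Q with
  | ECInf, _ => Q
  | _, ECInf => P
  | ECAff x1 y1, ECAff x2 y2 =>
      if (x1 == x2) && (y1 == - y2) then ECInf else
      let l := if x1 == x2 then (3 * x1 ^+ 2 + a) / (2 * y1)
               else (y2 - y1) / (x2 - x1) in
      let x3 := l ^+ 2 - x1 - x2 in
      ECAff x3 (l * (x1 - x3) - y1)
  end.

Definition ecmul (n : nat) (P : ecpoint) : ecpoint := iter n (ecadd P) ECInf.

Definition nontorsion (P : ecpoint) : Prop :=
  forall n : nat, (0 < n)%N -> ecmul n P <> ECInf.

End ShortWeierstrass.

Arguments ECInf {F}.
Arguments ECAff {F} _ _.

Definition cube_free (m : int) : Prop :=
  forall d : int, (d ^+ 3 %| m)%Z -> `|d| = 1.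

(* Sequences are indexed from 1; the value at 0 is ignored. *)
Definition primitive_divisor (A : nat -> int) (n : nat) (d : int) : Prop :=
  [/\ 1 < d, (d %| A n)%Z &
      forall k : nat, (0 < k < n)%N -> A k != 0 -> coprimez d (A k)].

Definition no_primitive_divisor (A : nat -> int) : set nat :=
  [set n | (0 < n)%N /\ ~ exists d : int, primitive_divisor A n d].

(* The maximum of an empty family of naturals is 0. *)
Definition zsigmondy_bound (A : nat -> int) : \bar int :=
  if `[< finite_set (no_primitive_divisor A) >]
  then ((\max_(n <- fset_set (no_primitive_divisor A)) n)%N%:Z)%:E
  else +oo%E.

Definition mordell_b (m : int) : rat := - (432 * m%:Q ^+ 2).

(* Main.v *)
Require Import Defs.
From mathcomp Require Import all_boot all_order all_algebra.
From mathcomp Require Import constructive_ereal.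
From mathcomp Require Import ring lra zify.
From mathcomp Require Import boolp classical_sets cardinality reals exp Rstruct.

Import Order.TTheory GRing.Theory Num.Theory.
Local Open Scope ring_scope.

Set Implicit Arguments.
Unset Strict Implicit.

(** With k = 432 m^2 one has A_n^3 = C_n^2 + k B_n^6, so x(nQ) is bounded
    below by k^(1/3) and ln A_n is the naive height of nQ. It satisfies the
    parallelogram inequality with the constant ln 9, hence is within O(1) of a
    quadratic function n^2 h; the other inequality loses only the
    cancellation in the duplication formula, which is controlled by the primes
    dividing 6m.

    If p >= 5 divides A_n and an earlier term, then nQ is p-adically close to
    the 3-torsion point T = (0, sqrt(-k)), and 3nQ is close to the origin or
    nonsingular; comparing 3nQ with 3(n/q)Q for a suitable prime q <> 3
    dividing n gives v_p(A_n) <= v_p(A_(n/q)) + v_p(n). So without a primitive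
    divisor, A_n is at most 36 n times the product of the A_(n/q) over the
    primes q <> 3 dividing n. As the sum of the 1/q^2 is small, this
    contradicts quadratic growth once h is bounded below, and the bound on h
    comes from Q, 2Q or 3Q, the last one being nonsingular at every p >= 5. *)

(** * Addition on y^2 = x^3 - k in terms of u = 1/x *)

(** Associativity of the group law is never established; everything rests on the sum and the product
    of the abscissas of P+Q and P-Q. These are written for u = 1/x because infinity then has the
    value 0, and because k > 0 forces x > 0 on the curve, so that the common denominator [addden] is
    always positive and no exceptional pairs remain.

    The p-adic comparison of 3nQ with 3(n/q)Q needs 2 and 3 to be units, so the divisibility
    estimate is made only for the part S_n of A_n prime to 6. The rest of A_n divides 36, and a
    duplication costs only a factor 9 at 2 and 3. With E the error in ln S_n <= n^2 h + E, the final
    contradiction asks for ln 125 - ln 9 <= 27 h and E <= 29 h. The obstacle is that E may involve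
    ln m; then m is bounded by a power of S_3, so that a large m also makes h large. *)

Section AddLaw.
Variables (F : fieldType) (k : F).

(* For u = 1/x on y^2 = x^3 - k, with a = u(P) and b = u(Q):
   (u(P+Q) + u(P-Q)) * addden a b = addsum a b and
   u(P+Q) * u(P-Q) * addden a b = (a - b)^2. *)
Definition addden (a b : F) := 1 + 4 * k * a * b * (a + b).
Definition addsum (a b : F) := 2 * (a + b - 2 * k * a ^+ 2 * b ^+ 2).

(* The sum and the product of u(P+Q+R), u(P+Q-R), u(P-Q+R), u(P-Q-R) are
   symmetric in (P, Q, R). Here they are written in terms of the pair
   u(P+Q), u(P-Q), scaled by addden, with d = addden a b, s = addsum a b and
   m = (a - b)^2. *)
Definition foursum_poly (c d s m : F) := 2 * (
    s * d + 2 * c * d ^+ 2 - 2 * k * c ^+ 2 * (s ^+ 2 - 2 * m * d)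
    + 4 * k * c * (m * s + c * (s ^+ 2 - 2 * m * d))
    + 4 * k * c ^+ 2 * (2 * m * d + c * s * d)
    - 16 * k ^+ 2 * c ^+ 3 * m ^+ 2 - 8 * k ^+ 2 * c ^+ 4 * m * s).
Definition fourden_poly (c d s m : F) :=
  d ^+ 2 + 4 * k * c * (s ^+ 2 - 2 * m * d) + 4 * k * c ^+ 2 * s * d
  + 16 * k ^+ 2 * c ^+ 2 * (m ^+ 2 + c * m * s + c ^+ 2 * m * d).
Definition foursum (a b c : F) :=
  foursum_poly c (addden a b) (addsum a b) ((a - b) ^+ 2).
Definition fourden (a b c : F) :=
  fourden_poly c (addden a b) (addsum a b) ((a - b) ^+ 2).
Definition fourprod (a b c : F) :=
  a ^+ 2 + b ^+ 2 + c ^+ 2 - 2 * a * b - 2 * a * c - 2 * b * c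
  + 4 * k * a * b * c * (a * b + b * c + c * a).

Lemma fourdenC a b c : fourden a b c = fourden b c a.
Proof. rewrite /fourden /fourden_poly /addden /addsum; ring. Qed.
Lemma foursumC a b c : foursum a b c = foursum b c a.
Proof. rewrite /foursum /foursum_poly /addden /addsum; ring. Qed.
Lemma fourprodC a b c : fourprod a b c = fourprod b c a.
Proof. rewrite /fourprod; ring. Qed.

Lemma addsumC a b : addsum a b = addsum b a.
Proof. rewrite /addsum; ring. Qed.
Lemma adddenC a b : addden a b = addden b a.
Proof. rewrite /addden; ring. Qed.

Section Pair.
Variables (a b c p q : F).
Hypothesis (Epq : (p + q) * addden a b = addsum a b).
Hypothesis (Mpq : p * q * addden a b = (a - b) ^+ 2).

Lemma fourdenE : fourden a b c = addden a b ^+ 2 * (addden p c * addden q c).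
Proof.
rewrite /fourden -Epq -Mpq; move: (addden a b) => d.
rewrite /fourden_poly /addden; ring.
Qed.

Lemma foursumE : foursum a b c =
  addden a b ^+ 2 * (addsum p c * addden q c + addsum q c * addden p c).
Proof.
rewrite /foursum -Epq -Mpq; move: (addden a b) => d.
rewrite /foursum_poly /addsum /addden; ring.
Qed.

(** The two values built on [p] have product (p - c)^2 / [addden p c], and likewise for [q]. So
    [fourprod] squared is [fourden] times the product of all four values, and this square root is
    symmetric as well. *)
Lemma fourprodE : fourprod a b c = addden a b * ((p - c) * (q - c)).
Proof.
rewrite (_ : addden a b * _ =
  p * q * addden a b - c * ((p + q) * addden a b) + c ^+ 2 * addden a b); last by ring.
rewrite Epq Mpq /fourprod /addsum /addden; ring.
Qed.
End Pair.

End AddLaw.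

(* [p, q] stand for u(P+Q), u(P-Q), [r, s] for u(Q+R), u(Q-R), [p1, p0] for
   u(P+Q+R), u(P+Q-R) and [q0, q1] for u(P-Q+R), u(P-Q-R): the symmetry of the
   four-point sum and product takes the place of associativity. *)
Lemma addlaw_step (F : fieldType) (k a b c p q r s p0 p1 q0 q1 : F) :
  addden k b c != 0 -> addden k s a != 0 -> p0 * q0 != 0 ->
  (p + q) * addden k a b = addsum k a b -> p * q * addden k a b = (a - b) ^+ 2 ->
  (r + s) * addden k b c = addsum k b c -> r * s * addden k b c = (b - c) ^+ 2 ->
  (p1 + p0) * addden k p c = addsum k p c -> p1 * p0 * addden k p c = (p - c) ^+ 2 ->
  (q0 + q1) * addden k q c = addsum k q c -> q0 * q1 * addden k q c = (q - c) ^+ 2 ->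
  (p0 + q0) * addden k s a = addsum k s a -> p0 * q0 * addden k s a = (s - a) ^+ 2 ->
  (p1 + q1) * addden k r a = addsum k r a /\ p1 * q1 * addden k r a = (r - a) ^+ 2.
Proof.
move=> d2 ds n0 S1 P1 S2 P2 Sp Pp Sq Pq Ss Ps.
have := foursumE c S1 P1; rewrite foursumC (foursumE a S2 P2).
have := fourdenE c S1 P1; rewrite fourdenC (fourdenE a S2 P2).
have := fourprodE c S1 P1; rewrite fourprodC (fourprodE a S2 P2).
rewrite -Sp -Sq -Ss.
move: (addsum k r a) (addden k r a) (addden k s a) (addden k p c) (addden k q c)
  (addden k a b) (addden k b c) d2 ds Pp Pq Ps => Sr Dr Ds Dp Dq D1 D2 d2 ds Pp Pq Ps EQ ED ES.
split.
  have n : D2 ^+ 2 * Ds != 0 := mulf_neq0 (expf_neq0 2 d2) ds.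
  apply: (mulfI n).
  transitivity (D2 ^+ 2 * (Dr * Ds) * (p1 + q1)); first by ring.
  transitivity (D2 ^+ 2 * (Sr * Ds + (p0 + q0) * Ds * Dr) - D2 ^+ 2 * (Dr * Ds) * (p0 + q0)).
    by rewrite ES ED; ring.
  by ring.
(* The known pair [p0], [q0] is divided out of the product of all four values, hence both must be
   non-zero. *)
have n : D2 ^+ 2 * (Ds * (p0 * q0)) != 0 := mulf_neq0 (expf_neq0 2 d2) (mulf_neq0 ds n0).
apply: (mulfI n).
transitivity (D2 ^+ 2 * (Dr * Ds) * (p1 * q1 * p0 * q0)); first by ring.
rewrite ED.
transitivity (D1 ^+ 2 * (p1 * p0 * Dp) * (q0 * q1 * Dq)); first by ring.
rewrite Pp Pq.
transitivity ((D1 * ((p - c) * (q - c))) ^+ 2); first by ring.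
rewrite -EQ.
transitivity (D2 ^+ 2 * (r - a) ^+ 2 * (s - a) ^+ 2); first by ring.
by rewrite -Ps; ring.
Qed.

(** * The addition law for all pairs of multiples *)

Section XSequence.
Variables (F : realFieldType) (k : F) (u : nat -> F).

Definition xlaw (i j : nat) :=
  (u (i + j)%N + u (i - j)%N) * addden k (u i) (u j) = addsum k (u i) (u j) /\
  u (i + j)%N * u (i - j)%N * addden k (u i) (u j) = (u i - u j) ^+ 2.

Hypotheses (k_ge0 : 0 <= k) (u0 : u 0%N = 0) (u_gt0 : forall n, (0 < n)%N -> 0 < u n).
Hypothesis xlaw1 : forall i, (0 < i)%N -> xlaw i 1.

Lemma xseq_ge0 n : 0 <= u n.
Proof. by case: n => [|n]; [rewrite u0 | rewrite ltW // u_gt0]. Qed.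

Lemma addden_gt0 i j : 0 < addden k (u i) (u j).
Proof.
by rewrite /addden ltr_pwDl // !mulr_ge0 ?addr_ge0 ?xseq_ge0 //.
Qed.

(** Two-step induction on j: with a, b, c = u_i, u_(j+1), u_1, [addlaw_step] passes from u_(i+j),
    u_(i-j) to u_(i+j+2), u_(i-j-2), so only the addition of the first point has to be computed. *)
Lemma xlaw_all j i : (j <= i)%N -> xlaw i j.
Proof.
have den_neq0 a b : addden k (u a) (u b) != 0 by rewrite gt_eqF // addden_gt0.
have xlaw0 a : xlaw a 0.
  by rewrite /xlaw addn0 subn0 u0 /addden /addsum; split; ring.
elim/ltn_ind: j i => -[|[|j]] IH i leji //; first by apply: xlaw1.
have [S1 P1] : xlaw i j.+1 by apply: IH => //; apply: ltnW.
have [S2 P2] : xlaw i j by apply: IH; rewrite ?ltnS //; do 2 apply: ltnW.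
have [S3 P3] : xlaw (i + j.+1) 1 by apply: xlaw1; rewrite addnS.
have [S4 P4] : xlaw (i - j.+1) 1 by apply: xlaw1; rewrite subn_gt0.
have [S5 P5] := xlaw1 (ltn0Sn j).
have e1 : (i + j.+1 + 1 = i + j.+2)%N by lia.
have e2 : (i + j.+1 - 1 = i + j)%N by lia.
have e3 : (i - j.+1 + 1 = i - j)%N by lia.
have e4 : (i - j.+1 - 1 = i - j.+2)%N by lia.
rewrite e1 e2 in S3 P3; rewrite e3 e4 in S4 P4; rewrite addn1 subn1 in S5 P5.
rewrite /xlaw adddenC addsumC -sqrrN opprB.
apply: (@addlaw_step _ k (u i) (u j.+1) (u 1%N) (u (i + j.+1)%N) (u (i - j.+1)%N)
  (u j.+2) (u j) (u (i + j)%N) _ (u (i - j)%N)) => //.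
- by rewrite gt_eqF // mulr_gt0 // u_gt0 //; lia.
- by rewrite adddenC addsumC.
- by rewrite adddenC P2 -sqrrN opprB.
Qed.
End XSequence.

(** * Chord and tangent identities *)

Section Chord.
Variable F : fieldType.

Lemma inv_addlaw (k x z p q : F) :
  x != 0 -> z != 0 -> p != 0 -> q != 0 -> x - z != 0 ->
  (p + q) * (x - z) ^+ 2 = 2 * ((x + z) * (x * z) - 2 * k) ->
  p * q * (x - z) ^+ 2 = (x * z) ^+ 2 + 4 * k * (x + z) ->
  (p^-1 + q^-1) * addden k x^-1 z^-1 = addsum k x^-1 z^-1 /\
  p^-1 * q^-1 * addden k x^-1 z^-1 = (x^-1 - z^-1) ^+ 2.
Proof.
move=> x0 z0 p0 q0 d0 S P.
have DE : addden k x^-1 z^-1 = p * q * (x - z) ^+ 2 / (x * z) ^+ 2.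
  by rewrite P /addden; field; rewrite x0 z0.
have SE : addsum k x^-1 z^-1 = (p + q) * (x - z) ^+ 2 / (x * z) ^+ 2.
  by rewrite S /addsum; field; rewrite x0 z0.
by rewrite DE SE; split; field; rewrite ?x0 ?z0 ?p0 ?q0.
Qed.

(** The cubic minus the square of the line has the roots x1, x2 and l^2 - x1 - x2; the factor x2 -
    x1 clears the divided difference that extracts the third root. *)
Lemma chord_oncurve (b x1 y1 x2 y2 l : F) : x1 != x2 ->
  y1 ^+ 2 = x1 ^+ 3 + b -> y2 ^+ 2 = x2 ^+ 3 + b -> l * (x2 - x1) = y2 - y1 ->
  (l * (x1 - (l ^+ 2 - x1 - x2)) - y1) ^+ 2 = (l ^+ 2 - x1 - x2) ^+ 3 + b.
Proof.
move=> ne E1 E2 El.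
have d0 : x2 - x1 != 0 by rewrite subr_eq0 eq_sym.
apply/eqP; rewrite -subr_eq0; apply/eqP; apply: (mulfI d0); rewrite mulr0.
transitivity (- ((x1 ^+ 3 + b - y1 ^+ 2) * (x2 - x1) + (l ^+ 2 - x1 - x2 - x1) *
  (x2 ^+ 3 + b - (l * (x2 - x1) + y1) ^+ 2 - (x1 ^+ 3 + b - y1 ^+ 2)))); first by ring.
by rewrite El E1 subrK E2; ring.
Qed.

Lemma tangent_oncurve (b x1 y1 l : F) :
  y1 ^+ 2 = x1 ^+ 3 + b -> l * (2 * y1) = 3 * x1 ^+ 2 ->
  (l * (x1 - (l ^+ 2 - x1 - x1)) - y1) ^+ 2 = (l ^+ 2 - x1 - x1) ^+ 3 + b.
Proof.
move=> E1 El.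
apply/eqP; rewrite -subr_eq0; apply/eqP.
transitivity (- ((x1 ^+ 3 + b - y1 ^+ 2) + (l ^+ 2 - x1 - x1 - x1) *
  (3 * x1 ^+ 2 - l * (2 * y1)))); first by ring.
by rewrite El E1; ring.
Qed.

Lemma chord_sum_prod (k x y z t p q : F) : x - z != 0 ->
  y ^+ 2 = x ^+ 3 - k -> t ^+ 2 = z ^+ 3 - k ->
  p = ((y - t) / (x - z)) ^+ 2 - z - x -> q = ((y + t) / (x - z)) ^+ 2 - z - x ->
  (p + q) * (x - z) ^+ 2 = 2 * ((x + z) * (x * z) - 2 * k) /\
  p * q * (x - z) ^+ 2 = (x * z) ^+ 2 + 4 * k * (x + z).
Proof.
move=> d0 Ex Ez Ep Eq; split.
  transitivity (2 * (y ^+ 2 + t ^+ 2) - 2 * (x + z) * (x - z) ^+ 2).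
    by rewrite Ep Eq; field.
  by rewrite Ex Ez; ring.
apply: (mulfI (expf_neq0 2 d0)).
transitivity ((y ^+ 2 - t ^+ 2) ^+ 2 - (x + z) * (x - z) ^+ 2 * (2 * (y ^+ 2 + t ^+ 2))
   + (x + z) ^+ 2 * (x - z) ^+ 4).
  by rewrite Ep Eq; field.
by rewrite Ex Ez; ring.
Qed.
End Chord.

(** * Multiples of a non-torsion point *)

Section Multiples.
Variables (F : realFieldType) (k : F) (Q : ecpoint F).
Hypotheses (k_gt0 : 0 < k) (Qk : oncurve 0 (- k) Q) (Qnt : nontorsion 0 Q).

Definition xinv (n : nat) : F := if ecmul 0 n Q is ECAff x _ then x^-1 else 0.

Lemma oncurve_x_gt0 (x y : F) : y ^+ 2 = x ^+ 3 - k -> 0 < x.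
Proof.
move=> E; rewrite ltNge; apply/negP => x0.
have := sqr_ge0 y; rewrite E leNgt => /negP; apply.
by rewrite subr_lt0; apply: le_lt_trans k_gt0; rewrite exprn_odd_le0.
Qed.

Lemma ecmul_affine n : (0 < n)%N -> exists x y, [/\ ecmul 0 n Q = ECAff x y,
  y ^+ 2 = x ^+ 3 - k & 0 < x].
Proof.
have base : forall P, oncurve 0 (- k) P -> P <> ECInf -> exists x y,
    [/\ P = ECAff x y, y ^+ 2 = x ^+ 3 - k & 0 < x].
  case=> // x y /= E _; rewrite mul0r addr0 in E.
  by exists x, y; split => //; apply: oncurve_x_gt0 E.
move=> n0; apply: base; last exact: Qnt.
elim: n n0 => // -[_ _|n /(_ isT) + _].
  by rewrite /ecmul /=; case: (Q) Qk.
have -> : ecmul 0 n.+2 Q = ecadd 0 Q (ecmul 0 n.+1 Q) by [].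
case: (ecmul 0 n.+1 Q) => [|x2 y2]; case: (Q) Qk => [|x1 y1] //=.
rewrite !mul0r !addr0 => E1 E2.
case: ifP => // ne /=.
rewrite mul0r addr0; case: eqP ne => [xE /= ne|/eqP xne _].
  rewrite -xE in E2 *; apply: tangent_oncurve => //.
  rewrite divfK // mulf_neq0 ?pnatr_eq0 //; apply: contraFneq ne => y0.
  have : y2 ^+ 2 = 0 by rewrite E2 -E1 y0 expr0n.
  by move/eqP; rewrite expf_eq0 /= => /eqP ->; rewrite y0 oppr0.
apply: (@chord_oncurve _ _ _ _ _ y2) => //.
by rewrite divfK // subr_eq0 eq_sym.
Qed.

Lemma xinv_gt0 n : (0 < n)%N -> 0 < xinv n.
Proof.
by move=> /ecmul_affine [x [y [E _ x0]]]; rewrite /xinv E invr_gt0.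
Qed.

Lemma xinv0 : xinv 0 = 0. Proof. by []. Qed.

Lemma ecadd_affine (x1 y1 x2 y2 x3 y3 : F) :
  ecadd 0 (ECAff x1 y1) (ECAff x2 y2) = ECAff x3 y3 ->
  exists l, [/\ x3 = l ^+ 2 - x1 - x2, y3 = l * (x1 - x3) - y1 &
    if x1 == x2 then l = 3 * x1 ^+ 2 / (2 * y1) else l = (y2 - y1) / (x2 - x1)].
Proof.
rewrite /=; case: ifP => // _ [<- <-]; rewrite addr0.
by case: ifP => _; eexists.
Qed.

(** For doubling this is the duplication formula. Otherwise no subtraction of [Q] is available, so
    the abscissa of the preceding multiple is recovered from the addition that produced the current
    one. *)
Lemma xinv_law1 n : (0 < n)%N -> xlaw k xinv n 1.
Proof.
case: n => // n _; rewrite /xlaw addn1 subn1.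
have [z [t [EQ Ez z0]]] := ecmul_affine (ltn0Sn 0).
have {}EQ : Q = ECAff z t by rewrite -EQ /ecmul /=; case: (Q).
have u1 : xinv 1 = z^-1 by rewrite /xinv /ecmul /= EQ.
have [x [y [EP Ex x0]]] := ecmul_affine (ltn0Sn n).
have [p [p' [Ep Ep' p0]]] := ecmul_affine (ltn0Sn n.+1).
have -> : xinv n.+2 = p^-1 by rewrite /xinv Ep.
have uE : xinv n.+1 = x^-1 by rewrite /xinv EP.
rewrite u1 uE /=.
have EP2 : ecmul 0 n.+2 Q = ecadd 0 Q (ecmul 0 n.+1 Q) by [].
rewrite EP2 EP EQ in Ep; have [l [pE _ lE]] := ecadd_affine Ep.
case: n => [|n] in EP EP2 uE Ep Ex x0 pE lE *.
  have xz : x = z by move: EP; rewrite /ecmul /= EQ => -[].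
  have yt : y = t by move: EP; rewrite /ecmul /= EQ => -[].
  rewrite xz eqxx in lE pE; rewrite xz xinv0 addr0.
  have t0 : t != 0.
    by apply/eqP => t0; move: Ep; rewrite xz yt t0 /= oppr0 !eqxx.
  have pE2 : p * (4 * t ^+ 2) = z * (z ^+ 3 + 8 * k).
    transitivity (9 * z ^+ 4 - 8 * z * t ^+ 2); last by rewrite Ez; ring.
    by rewrite pE lE; field.
  have p1 : p != 0 by rewrite gt_eqF.
  have z1 : z != 0 by rewrite gt_eqF.
  have t1 : z ^+ 3 - k != 0 by rewrite -Ez expf_neq0.
  have -> : p^-1 = 4 * (z ^+ 3 - k) / (z * (z ^+ 3 + 8 * k)).
    by rewrite -pE2 -Ez; field; rewrite p1 t0.
  have k1 : z ^+ 3 + 8 * k != 0.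
    by rewrite gt_eqF // addr_gt0 ?exprn_gt0 ?mulr_gt0.
  by rewrite /addden /addsum; split; field; rewrite ?z1 ?k1.
have [q [q' [Eq Eq' q0]]] := ecmul_affine (ltn0Sn n).
have -> : xinv n.+1 = q^-1 by rewrite /xinv Eq.
have EP3 : ecmul 0 n.+2 Q = ecadd 0 Q (ecmul 0 n.+1 Q) by [].
rewrite EP3 Eq EQ in EP; have [l' [xE yE _]] := ecadd_affine EP.
(* Equal abscissas force y = -t by [yE], and then the next multiple would be infinity. *)
have zx : (z == x) = false.
  apply: contra_notF (Qnt (ltn0Sn n.+2)) => /eqP zx.
  by rewrite EP2 EP3 Eq EQ EP /= yE zx subrr mulr0 sub0r opprK !eqxx.
rewrite zx in lE.
have xz0 : x - z != 0 by rewrite subr_eq0 eq_sym zx.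
(* The line of slope [l'] through [Q] meets the curve again in the negative of the current multiple,
   so [l'] is the slope between (z, t) and (x, -y), even where it arose as a tangent. *)
have l'E : l' = - ((y + t) / (x - z)).
  by apply: (mulIf xz0); rewrite mulNr divfK // yE; ring.
have [] := @chord_sum_prod F k x y z t p q xz0 Ex Ez.
- by rewrite pE lE; ring.
- rewrite -[in RHS]sqrrN -l'E {1}xE; ring.
by apply: inv_addlaw => //; rewrite gt_eqF.
Qed.

Lemma xinv_law i j : (j <= i)%N -> xlaw k xinv i j.
Proof.
by apply: xlaw_all => //; [exact: ltW | exact: xinv_gt0 | exact: xinv_law1].
Qed.
End Multiples.

(** * p-integral rationals *)

Section Padic.
Variable p : nat.
Hypothesis p_pr : prime p.

(** The condition v_p(x) >= e, which 0 satisfies for every e; an explicit fraction avoids a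
    valuation with a special value at 0. *)
Definition padic (e : nat) (x : rat) : Prop :=
  exists a d : int, ~~ (p %| d)%Z /\ x = (p%:Z ^+ e * a)%:~R / d%:~R.

Definition padic_unit (x : rat) : Prop :=
  exists a d : int, [/\ ~~ (p %| a)%Z, ~~ (p %| d)%Z & x = a%:~R / d%:~R].

Lemma prime_dvdzM (a b : int) : (p %| a * b)%Z = (p %| a)%Z || (p %| b)%Z.
Proof. by rewrite !dvdzE abszM Euclid_dvdM. Qed.

Lemma prime_dvdzX (a : int) n : (p %| a ^+ n)%Z = (p %| a)%Z && (0 < n)%N.
Proof. by rewrite !dvdzE abszX Euclid_dvdX. Qed.

Lemma ndvdz_neq0 (d : int) : ~~ (p %| d)%Z -> d%:~R != 0 :> rat.
Proof. by rewrite intr_eq0; apply: contraNneq => ->; rewrite dvdz0. Qed.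

Lemma ndvdz1 : ~~ (p %| 1)%Z.
Proof. by rewrite dvdzE /= Euclid_dvd1. Qed.

Lemma padicM e f x y : padic e x -> padic f y -> padic (e + f) (x * y).
Proof.
move=> [a [d [nd ->]]] [b [c [nc ->]]]; exists (a * b), (d * c).
rewrite prime_dvdzM negb_or nd nc; split => //.
by rewrite exprD !rmorphM /=; field; rewrite !ndvdz_neq0.
Qed.

Lemma padicD e x y : padic e x -> padic e y -> padic e (x + y).
Proof.
move=> [a [d [nd ->]]] [b [c [nc ->]]]; exists (a * c + b * d), (d * c).
rewrite prime_dvdzM negb_or nd nc; split => //.
by rewrite !rmorphM rmorphD /= !rmorphM /=; field; rewrite !ndvdz_neq0.
Qed.

Lemma padicN e x : padic e x -> padic e (- x).
Proof.
move=> [a [d [nd ->]]]; exists (- a), d; split => //.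
by rewrite mulrN rmorphN mulNr.
Qed.

Lemma padicB e x y : padic e x -> padic e y -> padic e (x - y).
Proof. by move=> hx hy; apply: padicD => //; apply: padicN. Qed.

Lemma padicW e f x : (f <= e)%N -> padic e x -> padic f x.
Proof.
move=> fe [a [d [nd ->]]]; exists (p%:Z ^+ (e - f) * a), d; split => //.
by rewrite mulrA -exprD subnKC.
Qed.

Lemma padic_dvd e (z : int) : (p%:Z ^+ e %| z)%Z -> padic e z%:~R.
Proof.
move=> /dvdzP[q ->]; exists q, 1; split; first exact: ndvdz1.
by rewrite mulrC divr1.
Qed.

Lemma padic_int (z : int) : padic 0 z%:~R.
Proof. by apply: padic_dvd; rewrite expr0 dvd1z. Qed.

Lemma padic_nat n : padic 0 n%:R.
Proof. by rewrite -[n%:R]/((n%:Z)%:~R); apply: padic_int. Qed.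

Lemma dvd_padic e (z : int) : padic e z%:~R -> (p%:Z ^+ e %| z)%Z.
Proof.
move=> [a [d [nd /eqP]]].
rewrite eq_sym -(inj_eq (mulIf (ndvdz_neq0 nd))) divfK ?ndvdz_neq0 //.
rewrite -rmorphM eqr_int => /eqP E.
rewrite -(@Gauss_dvdzl _ _ d); first by rewrite -E dvdz_mulr.
by rewrite /coprimez; apply: coprimezXl; rewrite coprimezE prime_coprime -?dvdzE.
Qed.

Lemma padic0M e x y : padic 0 x -> padic e y -> padic e (x * y).
Proof. by move=> hx hy; rewrite -[e]add0n; apply: padicM. Qed.

Lemma padicM0 e x y : padic e x -> padic 0 y -> padic e (x * y).
Proof. by move=> hx hy; rewrite mulrC; apply: padic0M. Qed.

Lemma padicX e x n : padic e x -> padic (n * e) (x ^+ n).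
Proof.
move=> hx; elim: n => [|n IH]; first by rewrite expr0; apply: (padic_nat 1).
by rewrite exprS mulSn; apply: padicM.
Qed.

Lemma padic0X x n : padic 0 x -> padic 0 (x ^+ n).
Proof. by move/(padicX n); rewrite muln0. Qed.

Lemma punit_padic x : padic_unit x -> padic 0 x.
Proof. by move=> [a [d [_ nd ->]]]; exists a, d; rewrite expr0 mul1r. Qed.

Lemma punitV x : padic_unit x -> padic_unit x^-1.
Proof.
move=> [a [d [na nd ->]]]; exists d, a; split => //.
by rewrite invf_div.
Qed.

Lemma punitM x y : padic_unit x -> padic_unit y -> padic_unit (x * y).
Proof.
move=> [a [d [na nd ->]]] [b [c [nb nc ->]]]; exists (a * b), (d * c).
rewrite !prime_dvdzM !negb_or na nb nc nd; split => //.
by rewrite !rmorphM /=; field; rewrite !ndvdz_neq0.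
Qed.

Lemma punitX x n : padic_unit x -> padic_unit (x ^+ n).
Proof.
move=> hx; elim: n => [|n IH]; last by rewrite exprS; apply: punitM.
by exists 1, 1; rewrite ndvdz1 expr0 divr1.
Qed.

Lemma punit_int (z : int) : ~~ (p %| z)%Z -> padic_unit z%:~R.
Proof. by move=> nz; exists z, 1; rewrite nz ndvdz1 divr1. Qed.

Lemma punit_nat n : ~~ (p %| n)%N -> padic_unit n%:R.
Proof. by move=> nn; apply: (@punit_int n). Qed.

Lemma punitD x y : padic_unit x -> padic 1 y -> padic_unit (x + y).
Proof.
move=> [a [d [na nd ->]]] [b [c [nc ->]]]; exists (a * c + p%:Z * b * d), (d * c).
have dp : (p %| p%:Z * b * d)%Z by rewrite -mulrA dvdz_mulr.
rewrite (rpredDr _ dp) !prime_dvdzM !negb_or nd na nc; split => //.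
by rewrite !rmorphM rmorphD expr1 /= !rmorphM /=; field; rewrite !ndvdz_neq0.
Qed.

Lemma punit_neq0 x : padic_unit x -> x != 0.
Proof.
by move=> [a [d [na nd ->]]]; apply: mulf_neq0; rewrite ?invr_eq0 ndvdz_neq0.
Qed.

Lemma punit_padic1 x : padic_unit x -> ~ padic 1 x.
Proof.
move=> [a [d [na nd ->]]] /padicM0 /(_ (padic_int d)); rewrite divfK ?ndvdz_neq0 //.
by move/dvd_padic; rewrite expr1 (negPf na).
Qed.

Lemma padic_divu e x y : padic_unit y -> padic e (x * y) -> padic e x.
Proof.
move=> uy /padicM0 /(_ (punit_padic (punitV uy))).
by rewrite mulfK // punit_neq0.
Qed.

End Padic.

(* If t_j = u(jP)/u(P) and w = k u(P)^3 then t_j = j^2 - w mul_coef(j) + O(w^2);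
   the linear term matters when p divides k exactly twice and j = p. *)
Definition mul_coef (n : nat) : int := ((n%:Z ^+ 8 - n%:Z ^+ 2) %/ 7)%Z.

Lemma mul_coefE n : mul_coef n * 7 = n%:Z ^+ 8 - n%:Z ^+ 2.
Proof.
apply: divzK; elim/ltn_ind: n => -[|[|n]] // IH.
have -> : n.+2%:Z ^+ 8 - n.+2%:Z ^+ 2 =
  2 * (n.+1%:Z ^+ 8 - n.+1%:Z ^+ 2) - (n%:Z ^+ 8 - n%:Z ^+ 2)
  + 7 * (8 * n.+1%:Z ^+ 6 + 20 * n.+1%:Z ^+ 4 + 8 * n.+1%:Z ^+ 2) by ring.
apply: rpredD; last by apply: dvdz_mulr.
by apply: rpredB; [apply: dvdz_mull|]; apply: IH.
Qed.

(** The coefficient of w when t_j = j^2 - w c_j is put into the addition law for jP and P. *)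
Lemma mul_coefSS n : mul_coef n.+2 + mul_coef n =
  2 * mul_coef n.+1 + 8 * n.+1%:Z ^+ 6 + 20 * n.+1%:Z ^+ 4 + 8 * n.+1%:Z ^+ 2.
Proof.
have /mulIf : 7%:Z != 0 by []; apply.
rewrite mulrDl mul_coefE mul_coefE 3!mulrDl -(mulrA 2) mul_coefE; ring.
Qed.

(** * p-adic expansion of u(jP) / u(P) *)

Section MulPadic.
Variable p : nat.
Hypothesis p_pr : prime p.

(** Division by 7 is harmless for p other than 7, and 7^8 - 7^2 keeps a factor 7 after it. *)
Lemma mul_coef_dvd : (p %| mul_coef p)%Z.
Proof.
have [p7|p7] := eqVneq p 7%N.
  have p0 : p%:Z != 0 by rewrite p7.
  apply/dvdzP; exists (p%:Z ^+ 6 - 1); apply: (mulIf p0).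
  have := mul_coefE p; rewrite (_ : 7 = p%:Z) => [->|]; last by rewrite p7.
  move: (p%:Z) => x; ring.
suff : (p %| mul_coef p * 7)%Z.
  rewrite prime_dvdzM // => /orP[//|]; rewrite dvdzE /= => /prime_nt_dvdP.
  by move=> h; case/eqP: p7; apply: h => //; case: (p) p_pr => [|[]].
by rewrite mul_coefE rpredB // dvdz_exp.
Qed.

Lemma padicM_ge e f g x y : (g <= e + f)%N -> padic p e x -> padic p f y -> padic p g (x * y).
Proof. by move=> h hx hy; apply: (padicW h); apply: padicM. Qed.

Ltac padic_tac := repeat first [assumption | match goal with
  | |- padic _ 0 (_ + _) => apply: (padicD p_pr)
  | |- padic _ 0 (- _) => apply: padicN
  | |- padic _ 0 (_ * _) => apply: (padic0M p_pr)
  | |- padic _ 0 (_ ^+ _) => apply: (padic0X p_pr)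
  | |- padic _ 0 1 => exact: (padic_nat p_pr 1)
  | |- padic _ 0 _%:R => exact: (padic_nat p_pr)
  | |- padic _ 0 _%:~R => exact: (padic_int p_pr)
  end].

Variables (w : rat) (t : nat -> rat).
Hypotheses (w2 : padic p 2 w) (t0 : t 0%N = 0) (t1 : t 1%N = 1).
Hypothesis tSS : forall j, (t j.+2 + t j) * (1 + 4 * w * t j.+1 * (t j.+1 + 1)) =
  2 * (t j.+1 + 1 - 2 * w * t j.+1 ^+ 2).

(** As p^2 divides w, terms in w^2 vanish modulo p^3 and only j^2 and the linear term survive; the
    factor of t_(j+2) in the recurrence is a unit, so no precision is lost. *)
Lemma padic_mul_approx j : padic p 3 (t j - (j%:R ^+ 2 - w * (mul_coef j)%:~R)).
Proof.
have p0 : padic p 3 0 by rewrite -[0]/(0%:~R); apply: padic_dvd; rewrite ?dvdz0.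
have w0 : padic p 0 w by apply: (padicW _ w2).
elim/ltn_ind: j => -[|[|j]] IH.
- by rewrite t0 (_ : mul_coef 0 = 0) // (_ : _ - _ = 0) //; ring.
- by rewrite t1 (_ : mul_coef 1 = 0) // (_ : _ - _ = 0) //; ring.
have := IH j.+1 (ltnSn _); have := IH j (leqnSn _); have := tSS j.
have : (mul_coef j.+2)%:~R + (mul_coef j)%:~R = 2 * (mul_coef j.+1)%:~R
  + 8 * j.+1%:R ^+ 6 + 20 * j.+1%:R ^+ 4 + 8 * j.+1%:R ^+ 2 :> rat.
  by rewrite -rmorphD mul_coefSS; ring.
have c0 := padic_int p_pr (mul_coef j.+1).
have c2 := padic_int p_pr (mul_coef j).
move: c0 c2; rewrite (_ : j.+2%:R = j.+1%:R + 1 :> rat); last by rewrite -natr1.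
rewrite (_ : j%:R = j.+1%:R - 1 :> rat); last by rewrite -natr1 addrK.
have := padic_nat p_pr j.+1.
move: (j.+1%:R : rat) (t j) (t j.+1) (t j.+2) (mul_coef j)%:~R (mul_coef j.+1)%:~R (mul_coef j.+2)%:~R.
move=> s x y z c d c' s0 d0 c0 cE zE; set e0 := x - _ => he0; set e1 := y - _ => he1.
have hs2 : padic p 0 (s ^+ 2) by padic_tac.
have hh : padic p 2 (y - s ^+ 2).
  have -> : y - s ^+ 2 = e1 + w * (- d) by rewrite /e1; ring.
  apply: padicD => //; first exact: (padicW _ he1).
  by apply: padicM0 => //; apply: padicN.
have h0 : padic p 0 (y - s ^+ 2) by apply: padicW hh.
have y0 : padic p 0 y by rewrite -(subrK (s ^+ 2) y); padic_tac.
have uD : padic_unit p (1 + 4 * w * y * (y + 1)).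
  apply: punitD => //; first by apply: (punit_nat p_pr (n := 1)); rewrite Euclid_dvd1.
  apply: (padicW (e := 2)) => //.
  rewrite -2!mulrA; apply: padic0M; padic_tac; apply: padicM0; padic_tac.
apply: (padic_divu p_pr uD).
(* What remains are multiples of the two earlier errors and terms with a factor w^2 or w (y - s^2),
   both of valuation at least 4. *)
have -> : (z - ((s + 1) ^+ 2 - w * c')) * (1 + 4 * w * y * (y + 1)) =
  2 * e1 - e0 - e0 * (4 * w * y * (y + 1))
  + w * w * (4 * (2 * d + 8 * s ^+ 6 + 20 * s ^+ 4 + 8 * s ^+ 2) * y * (y + 1))
  + w * (y - s ^+ 2) * (- (8 * s ^+ 2) - 4 * (y - s ^+ 2)
      - 8 * (s ^+ 2 + 1) * (2 * s ^+ 2 + (y - s ^+ 2) + 1)).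
  have -> : c' = 2 * d + 8 * s ^+ 6 + 20 * s ^+ 4 + 8 * s ^+ 2 - c by rewrite -cE addrK.
  rewrite mulrBl -[z](addrK x) mulrBl zE /e0 /e1; ring.
do !apply: padicD => //.
- by apply: padic0M => //; padic_tac.
- exact: padicN.
- by apply: padicN => //; apply: padicM0 => //; padic_tac.
- by apply: padicM0; padic_tac; apply: (padicM_ge _ w2 w2).
- by apply: padicM0; padic_tac; apply: (padicM_ge _ w2 hh).
Qed.

(** The leading term q^2 has valuation 2 or 0. For p = q the linear term could interfere at
    valuation 2, were [mul_coef p] not divisible by p. *)
Lemma padic_mul_prime q : prime q -> ~ padic p (1 + 2 * (p == q)) (t q).
Proof.
move=> q_pr; have hE := padic_mul_approx q.
have tE : t q = t q - (q%:R ^+ 2 - w * (mul_coef q)%:~R) + (q%:R ^+ 2 - w * (mul_coef q)%:~R).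
  by rewrite subrK.
have c0 := padic_int p_pr (mul_coef q).
have [pq|npq] := eqVneq p q.
  rewrite -{}pq {q q_pr} in hE tE c0 *; rewrite muln1 => h3.
  have : padic p 3 (p%:R ^+ 2).
    have -> : p%:R ^+ 2 = t p - (t p - (p%:R ^+ 2 - w * (mul_coef p)%:~R)) + w * (mul_coef p)%:~R.
      by ring.
    apply: padicD => //; first exact: padicB.
    apply: (padicM_ge (e := 2) (f := 1)) => //.
    by apply: padic_dvd; rewrite // expr1 mul_coef_dvd.
  rewrite (_ : p%:R ^+ 2 = (p%:Z ^+ 2)%:~R :> rat); last by rewrite rmorphXn.
  move/(dvd_padic p_pr); rewrite dvdzE !abszX /= => /dvdn_leq.
  by rewrite expn_gt0 prime_gt0 // leq_exp2l ?prime_gt1 // => /(_ isT).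
rewrite muln0 => h1; apply: (@punit_padic1 _ p_pr (q%:R ^+ 2)).
  by apply: punitX => //; apply: punit_nat => //; rewrite dvdn_prime2.
have -> : q%:R ^+ 2 = t q - (t q - (q%:R ^+ 2 - w * (mul_coef q)%:~R)) + w * (mul_coef q)%:~R.
  by ring.
apply: padicD => //; first by apply: padicB => //; apply: padicW hE.
by apply: padicM0 => //; apply: padicW w2.
Qed.
End MulPadic.

(** * The primes 2 and 3 *)

Lemma logn_absz_eq (p e : nat) (x y : int) : prime p -> x = p%:Z ^+ e * y ->
  ~~ (p %| y)%Z -> logn p `|x| = e.
Proof.
move=> p_pr -> py; have y0 : (0 < `|y|)%N.
  by rewrite absz_gt0; apply: contraNneq py => ->; rewrite dvdz0.
rewrite abszM abszX absz_nat lognM ?y0 ?expn_gt0 ?prime_gt0 // pfactorK //.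
by rewrite dvdzE /= in py; rewrite lognE p_pr y0 (negPf py) addn0.
Qed.

Lemma dvd2_witness (x : int) : (2 %| x)%Z -> exists y : int, x = 2 * y.
Proof. by move=> /dvdzP[y ->]; exists y; rewrite mulrC. Qed.

Lemma dvd2sqr (x y : int) : x ^+ 2 = 2 * y -> exists z : int, x = 2 * z.
Proof.
move=> E; apply: dvd2_witness; have : (2 %| x ^+ 2)%Z by rewrite E dvdz_mulr.
by rewrite (@prime_dvdzX 2) // andbT.
Qed.

Lemma dvd2cube (x y : int) : x ^+ 3 = 2 * y -> exists z : int, x = 2 * z.
Proof.
move=> E; apply: dvd2_witness; have : (2 %| x ^+ 3)%Z by rewrite E dvdz_mulr.
by rewrite (@prime_dvdzX 2) // andbT.
Qed.

Lemma odd_witness (x : int) : ~~ (2 %| x)%Z -> exists y : int, x = 2 * y + 1.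
Proof. by move=> h; exists (x %/ 2)%Z; lia. Qed.

Lemma odd_sqr (x : int) : ~~ (2 %| x)%Z -> exists y : int, x ^+ 2 = 8 * y + 1.
Proof.
move=> /odd_witness[y ->].
have [t tE] : exists t : int, y * (y + 1) = 2 * t.
  apply: dvd2_witness; rewrite (@prime_dvdzM 2) //; lia.
exists t; transitivity (4 * (y * (y + 1)) + 1); first by ring.
by rewrite tE; ring.
Qed.

(** Odd squares are 1 modulo 8, and 1 + 27 is 4 modulo 8. *)
Lemma sqr_27sqr_mod8 (x y z : int) : ~~ (2 %| y)%Z -> x ^+ 2 + 27 * y ^+ 2 = 2 * z ->
  exists t : int, z = 4 * t + 2.
Proof.
move=> oy E; have ox : ~~ (2 %| x)%Z.
  apply/negP => /dvd2_witness[x' xE]; have [s sE] := odd_sqr oy.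
  move: E; rewrite xE sE => E.
  have : 2 * (2 * x' ^+ 2 + 108 * s + 13) + 1 = 2 * z by rewrite -E; ring.
  by move: (2 * x' ^+ 2) => w; clear; lia.
have [s sE] := odd_sqr oy; have [t tE] := odd_sqr ox.
by exists (t + 27 * s + 3); move: E; rewrite sE tE; lia.
Qed.

Lemma mod4_absurd (x t : int) : 4 * x = 4 * t + 2 -> False.
Proof. lia. Qed.

Lemma coprimez_ndvd (p : nat) (a b : int) : prime p -> coprimez a b ->
  (p %| a)%Z -> ~~ (p %| b)%Z.
Proof.
move=> p_pr; rewrite coprimezE => /eqP g1 pa; apply/negP => pb.
have : (p %| gcdn `|a| `|b|)%N by rewrite dvdn_gcd; apply/andP.
by rewrite g1 Euclid_dvd1.
Qed.

(** As 432 = 16 * 27, an even a gives (a/2)^3 = 2 (c2^2 + 27 (m b^3)^2) with c = 4 c2. For odd m the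
    bracket is 4 modulo 8, which excludes 8 dividing a; for even m both c2 and m can be halved, at
    most twice since 8 does not divide m. *)
Lemma even_numer (a b c m : int) : coprimez a b ->
  a ^+ 3 = c ^+ 2 + 432 * m ^+ 2 * b ^+ 6 -> ~~ (8 %| m)%Z -> (2 %| a)%Z ->
  exists2 a' : int, a = 2%:Z ^+ 2 * a' & ~~ (2 %| a')%Z.
Proof.
move=> coab E m8 a2; have ob := @coprimez_ndvd 2 _ _ isT coab a2.
have [a1 aE] := dvd2_witness a2; rewrite aE in E *.
have [c1 cE] : exists c1 : int, c = 2 * c1.
  apply: (@dvd2sqr _ (4 * a1 ^+ 3 - 216 * m ^+ 2 * b ^+ 6)).
  by apply: (addIr (432 * m ^+ 2 * b ^+ 6)); rewrite -E; ring.
have E1 : c1 ^+ 2 = 2 * (a1 ^+ 3 - 54 * m ^+ 2 * b ^+ 6).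
  have /mulfI : 4 != 0 :> int by []; apply.
  apply: (addIr (432 * m ^+ 2 * b ^+ 6)); transitivity (c ^+ 2 + 432 * m ^+ 2 * b ^+ 6).
    by rewrite cE; ring.
  by rewrite -E; ring.
have [c2 c1E] := dvd2sqr E1.
have E2 : a1 ^+ 3 = 2 * (c2 ^+ 2 + 27 * m ^+ 2 * b ^+ 6).
  have /mulfI : 2 != 0 :> int by []; apply.
  by apply: (addIr (- (108 * m ^+ 2 * b ^+ 6))); transitivity (c1 ^+ 2); [rewrite E1 | rewrite c1E]; ring.
have [a2' a1E] := dvd2cube E2.
exists a2'; first by rewrite a1E; ring.
apply/negP => /dvd2_witness[a3 a2E].
have {}E2 : c2 ^+ 2 + 27 * (m * b ^+ 3) ^+ 2 = 2 * (16 * a3 ^+ 3).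
  have /mulfI : 2 != 0 :> int by []; apply.
  transitivity (a1 ^+ 3); first by rewrite E2; ring.
  by rewrite a1E a2E; ring.
have [|om] := boolP (2 %| m)%Z; last first.
  have /(sqr_27sqr_mod8) /(_ E2) [t] : ~~ (2 %| m * b ^+ 3)%Z.
    by rewrite (@prime_dvdzM 2) // (@prime_dvdzX 2) // andbT negb_or om ob.
  by move=> tE; apply: (@mod4_absurd (4 * a3 ^+ 3) t); rewrite -tE; ring.
move=> /dvd2_witness[m1 mE].
have [c3 c2E] : exists c3 : int, c2 = 2 * c3.
  apply: (@dvd2sqr _ (16 * a3 ^+ 3 - 54 * (m1 * b ^+ 3) ^+ 2)).
  apply: (addIr (27 * (m * b ^+ 3) ^+ 2)); rewrite E2 mE; ring.
have {}E2 : c3 ^+ 2 + 27 * (m1 * b ^+ 3) ^+ 2 = 2 * (4 * a3 ^+ 3).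
  have /mulfI : 4 != 0 :> int by []; apply.
  transitivity (c2 ^+ 2 + 27 * (m * b ^+ 3) ^+ 2); first by rewrite c2E mE; ring.
  by rewrite E2; ring.
have [|om] := boolP (2 %| m1)%Z; last first.
  have /(sqr_27sqr_mod8) /(_ E2) [t] : ~~ (2 %| m1 * b ^+ 3)%Z.
    by rewrite (@prime_dvdzM 2) // (@prime_dvdzX 2) // andbT negb_or om ob.
  by move=> tE; apply: (@mod4_absurd (a3 ^+ 3) t); rewrite -tE; ring.
move=> /dvd2_witness[m2 m1E].
have [c4 c3E] : exists c4 : int, c3 = 2 * c4.
  apply: (@dvd2sqr _ (4 * a3 ^+ 3 - 54 * (m2 * b ^+ 3) ^+ 2)).
  apply: (addIr (27 * (m1 * b ^+ 3) ^+ 2)); rewrite E2 m1E; ring.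
have {}E2 : c4 ^+ 2 + 27 * (m2 * b ^+ 3) ^+ 2 = 2 * a3 ^+ 3.
  have /mulfI : 4 != 0 :> int by []; apply.
  transitivity (c3 ^+ 2 + 27 * (m1 * b ^+ 3) ^+ 2); first by rewrite c3E m1E; ring.
  by rewrite E2; ring.
have om : ~~ (2 %| m2)%Z.
  apply/negP => /dvd2_witness[m3 m2E]; move/negP: m8; apply; apply/dvdzP; exists m3.
  by rewrite mE m1E m2E; ring.
have /(sqr_27sqr_mod8) /(_ E2) [t tE] : ~~ (2 %| m2 * b ^+ 3)%Z.
  by rewrite (@prime_dvdzM 2) // (@prime_dvdzX 2) // andbT negb_or om ob.
have [a4 a3E] : exists a4, a3 = 2 * a4.
  by apply: (@dvd2cube _ (2 * t + 1)); rewrite tE; ring.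
by apply: (@mod4_absurd (2 * a4 ^+ 3) t); rewrite -tE a3E; ring.
Qed.

Lemma dvd3_witness (x : int) : (3 %| x)%Z -> exists y : int, x = 3 * y.
Proof. by move=> /dvdzP[y ->]; exists y; rewrite mulrC. Qed.

Lemma dvd3pow (x y : int) n : (0 < n)%N -> x ^+ n = 3 * y -> exists z : int, x = 3 * z.
Proof.
move=> n0 E; apply: dvd3_witness; have : (3 %| x ^+ n)%Z by rewrite E dvdz_mulr.
by rewrite (@prime_dvdzX 3) // n0 andbT.
Qed.

Lemma three_sqr16 (x y : int) : ~~ (3 %| y)%Z -> (3 %| 16 * (x ^+ 2 * y ^+ 6))%Z ->
  exists z : int, x = 3 * z.
Proof.
move=> ny; rewrite (@prime_dvdzM 3 isT 16) (@prime_dvdzM 3 isT (x ^+ 2)).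
rewrite (@prime_dvdzX 3 isT x) (@prime_dvdzX 3 isT y) !andbT (negPf ny) orbF.
by move=> /orP[//|]; apply: dvd3_witness.
Qed.

(** Descent from 432 = 27 * 16: a second factor 3 of a forces 9 to divide m, and a third one would
    force 27. *)
Lemma threefold_numer (a b c m : int) : coprimez a b ->
  a ^+ 3 = c ^+ 2 + 432 * m ^+ 2 * b ^+ 6 -> ~~ (27 %| m)%Z -> (3 %| a)%Z ->
  (exists a1 c2 : int, [/\ a = 3 * a1, ~~ (3 %| a1)%Z, ~~ (3 %| m)%Z &
     a1 ^+ 3 = 3 * c2 ^+ 2 + 16 * m ^+ 2 * b ^+ 6]) \/
  (exists a2 m2 : int, [/\ a = 9 * a2, ~~ (3 %| a2)%Z & m = 9 * m2]).
Proof.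
move=> coab E m27 a3; have ob := @coprimez_ndvd 3 _ _ isT coab a3.
have [a1 aE] := dvd3_witness a3; rewrite {}aE {a3 coab} in E *.
have [c1 cE] : exists c1 : int, c = 3 * c1.
  apply: (@dvd3pow _ (9 * a1 ^+ 3 - 144 * m ^+ 2 * b ^+ 6) 2) => //.
  by apply: (addIr (432 * m ^+ 2 * b ^+ 6)); rewrite -E; ring.
rewrite {c}cE in E.
have E1 : c1 ^+ 2 = 3 * (a1 ^+ 3 - 16 * m ^+ 2 * b ^+ 6).
  have /mulfI : 9 != 0 :> int by []; apply.
  apply: (addIr (432 * m ^+ 2 * b ^+ 6)); transitivity ((3 * c1) ^+ 2 + 432 * m ^+ 2 * b ^+ 6).
    by ring.
  by rewrite -E; ring.
have [//|c2 cE] := @dvd3pow _ _ 2 _ E1.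
have {}E1 : a1 ^+ 3 = 3 * c2 ^+ 2 + 16 * m ^+ 2 * b ^+ 6.
  have /mulfI : 3 != 0 :> int by []; apply.
  by apply: (addIr (- (48 * m ^+ 2 * b ^+ 6))); transitivity (c1 ^+ 2); [rewrite E1 | rewrite cE]; ring.
have [|na1] := boolP (3 %| a1)%Z; last first.
  left; exists a1, c2; split => //; apply: contra na1 => /dvd3_witness[m1 mE].
  have {}E1 : a1 ^+ 3 = 3 * (c2 ^+ 2 + 48 * m1 ^+ 2 * b ^+ 6) by rewrite E1 mE; ring.
  by have [//|z ->] := @dvd3pow _ _ 3 _ E1; apply: dvdz_mulr.
move=> /dvd3_witness[a2 a1E]; right; clear E; rewrite {a1}a1E in E1 *.
have [m1 mE] : exists m1 : int, m = 3 * m1.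
  have : (3 %| 16 * (m ^+ 2 * b ^+ 6))%Z.
    rewrite (_ : 16 * _ = 3 * (9 * a2 ^+ 3 - c2 ^+ 2)) ?dvdz_mulr //.
    by apply: (addIr (3 * c2 ^+ 2)); transitivity ((3 * a2) ^+ 3); [rewrite E1|]; ring.
  by apply: three_sqr16.
rewrite {m}mE in m27 E1 *.
have E2 : c2 ^+ 2 = 3 * (3 * a2 ^+ 3 - 16 * m1 ^+ 2 * b ^+ 6).
  have /mulfI : 3 != 0 :> int by []; apply.
  by apply: (addIr (16 * (3 * m1) ^+ 2 * b ^+ 6)); rewrite -E1; ring.
have [//|c3 c2E] := @dvd3pow _ _ 2 _ E2.
have [m2 m1E] : exists m2 : int, m1 = 3 * m2.
  have : (3 %| 16 * (m1 ^+ 2 * b ^+ 6))%Z.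
    rewrite (_ : 16 * _ = 3 * (a2 ^+ 3 - c3 ^+ 2)) ?dvdz_mulr //.
    have /mulfI : 3 != 0 :> int by []; apply.
    by apply: (addIr (c2 ^+ 2)); rewrite {1}E2 c2E; ring.
  by apply: three_sqr16.
exists a2, m2; split; [by ring | | by rewrite m1E; ring].
apply/negP => /dvd3_witness[a3 a2E].
rewrite m1E a2E c2E in E2 m27.
have E3 : c3 ^+ 2 = 3 * (9 * a3 ^+ 3 - 16 * m2 ^+ 2 * b ^+ 6).
  have /mulfI : 9 != 0 :> int by []; apply.
  by transitivity ((3 * c3) ^+ 2); [|rewrite E2]; ring.
have [//|c4 c3E] := @dvd3pow _ _ 2 _ E3.
have : (3 %| 16 * (m2 ^+ 2 * b ^+ 6))%Z.
  rewrite (_ : 16 * _ = 3 * (3 * a3 ^+ 3 - c4 ^+ 2)) ?dvdz_mulr //.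
  have /mulfI : 3 != 0 :> int by []; apply.
  by apply: (addIr (c3 ^+ 2)); rewrite {1}E3 c3E; ring.
move=> /(three_sqr16 ob)[m3 m2E]; move/negP: m27; apply; apply/dvdzP; exists m3.
by rewrite m2E; ring.
Qed.

Lemma logn_absz0 (p : nat) (x : int) : prime p -> ~~ (p %| x)%Z -> logn p `|x| = 0%N.
Proof. by move=> p_pr px; apply: (logn_absz_eq (y := x)) => //; rewrite expr0 mul1r. Qed.

Lemma prime_dvdzXD (p n : nat) (x y : int) : prime p -> (0 < n)%N -> (p %| y)%Z ->
  (p %| x ^+ n + y)%Z = (p %| x)%Z.
Proof. by move=> p_pr n0 py; rewrite rpredDr // prime_dvdzX // n0 andbT. Qed.

Lemma logn2_numer (a b c m : int) : coprimez a b ->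
  a ^+ 3 = c ^+ 2 + 432 * m ^+ 2 * b ^+ 6 -> ~~ (8 %| m)%Z ->
  (logn 2 `|a| <= 2)%N /\
  (logn 2 `|(a * (a ^+ 3 + 8 * (432 * m ^+ 2) * b ^+ 6))%R| <= 4 * logn 2 `|a|)%N.
Proof.
move=> coab E m8; have [a2|na2] := boolP (2 %| a)%Z; last first.
  rewrite !logn_absz0 // (@prime_dvdzM 2) // negb_or na2 prime_dvdzXD //.
  by rewrite (_ : 8 * _ * _ = 2 * (1728 * m ^+ 2 * b ^+ 6)) ?dvdz_mulr //; ring.
have [a' aE oa] := even_numer coab E m8 a2.
have la : logn 2 `|a| = 2%N by apply: logn_absz_eq aE oa.
split; first by rewrite la.
rewrite la (@logn_absz_eq 2 8 _ (a' * (a' ^+ 3 + 2 * (27 * m ^+ 2 * b ^+ 6)))) //.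
  by rewrite aE; ring.
by rewrite (@prime_dvdzM 2) // negb_or oa prime_dvdzXD // dvdz_mulr.
Qed.

Lemma logn3_numer (a b c m : int) : coprimez a b ->
  a ^+ 3 = c ^+ 2 + 432 * m ^+ 2 * b ^+ 6 -> ~~ (27 %| m)%Z ->
  [/\ (logn 3 `|a| <= 2)%N, (1 < logn 3 `|a|)%N -> (9 %| m)%Z &
  (logn 3 `|(a * (a ^+ 3 + 8 * (432 * m ^+ 2) * b ^+ 6))%R| <= 4 * logn 3 `|a| + 2)%N].
Proof.
move=> coab E m27; have [a3|na3] := boolP (3 %| a)%Z; last first.
  rewrite !logn_absz0 // (@prime_dvdzM 3) // negb_or na3 prime_dvdzXD //.
  by rewrite (_ : 8 * _ * _ = 3 * (1152 * m ^+ 2 * b ^+ 6)) ?dvdz_mulr //; ring.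
have ob := @coprimez_ndvd 3 _ _ isT coab a3.
have [[a1 [c2 [aE na1 nm E1]]]|[a2 [m2 [aE na2 mE]]]] := threefold_numer coab E m27 a3; last first.
  have la : logn 3 `|a| = 2%N by apply: logn_absz_eq na2.
  rewrite la; split => //; first by move=> _; rewrite mE dvdz_mulr.
  rewrite (@logn_absz_eq 3 8 _ (a2 * (a2 ^+ 3 + 3 * (128 * m2 ^+ 2 * b ^+ 6)))) //.
    by rewrite aE mE; ring.
  by rewrite (@prime_dvdzM 3) // negb_or na2 prime_dvdzXD // dvdz_mulr.
have la : logn 3 `|a| = 1%N by apply: logn_absz_eq na1.
rewrite la; split => //.
(* Here a1^3 + 128 m^2 b^6 = 3 c2^2 + 144 m^2 b^6 has two factors 3 if 3 divides c2 and one
   otherwise; these two are the source of the 9 in the duplication estimate. *)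
have [/dvd3_witness[c3 c2E]|nc2] := boolP (3 %| c2)%Z.
  rewrite (@logn_absz_eq 3 6 _ (a1 * (16 * (m ^+ 2 * b ^+ 6) + 3 * c3 ^+ 2))) //.
    transitivity (81 * a1 * (a1 ^+ 3 + 128 * m ^+ 2 * b ^+ 6)); first by rewrite aE; ring.
    by rewrite E1 c2E; ring.
  rewrite (@prime_dvdzM 3) // negb_or na1 rpredDr /=; last exact: dvdz_mulr.
  apply/negP => /(three_sqr16 ob)[z mE]; move/negP: nm; apply.
  by rewrite mE dvdz_mulr.
rewrite (@logn_absz_eq 3 5 _ (a1 * (c2 ^+ 2 + 3 * (16 * m ^+ 2 * b ^+ 6)))) //.
  transitivity (81 * a1 * (a1 ^+ 3 + 128 * m ^+ 2 * b ^+ 6)); first by rewrite aE; ring.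
  by rewrite E1; ring.
by rewrite (@prime_dvdzM 3) // negb_or na1 prime_dvdzXD // dvdz_mulr.
Qed.

(** * The sequence of numerators *)

(* Gauss's lemma for the product of the linear forms (a, b) and (a', b'). *)
Lemma bezout_mul (R : comNzRingType) (a b a' b' s t s' t' : R) :
  s * a + t * b = 1 -> s' * a' + t' * b' = 1 ->
  exists x y z : R, x * (a * a') + y * (a * b' + a' * b) + z * (b * b') = 1.
Proof.
move=> E E'.
pose X := s * s' * (a * a') + t * t' * (b * b').
pose c := s * t'; pose d := t * s'.
have eX : 1 - X = c * (a * b') + d * (a' * b).
  transitivity ((s * a + t * b) * (s' * a' + t' * b') - X); first by rewrite E E' mulr1.
  by rewrite /X /c /d; ring.
exists (s * s' * (2 - X) + b * b' * (2 * c * d - c ^+ 2 - d ^+ 2)).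
exists (c ^+ 2 * (a * b') + d ^+ 2 * (a' * b)), (t * t' * (2 - X)).
transitivity (X * (2 - X) + (c * (a * b') + d * (a' * b)) ^+ 2).
  by rewrite {3}/X; ring.
by rewrite -eX; ring.
Qed.

(** The Bezout relation for the product form, applied to (N, M, D) instead, yields the factor G
    itself. *)
Lemma coprimez_primitive (a b a' b' N M D : int) : coprimez a b -> coprimez a' b' ->
  a * a' != 0 -> N * (a * b' + a' * b) = M * (a * a') -> N * (b * b') = D * (a * a') ->
  exists G : int, [/\ G * (a * a') = N, G * (a * b' + a' * b) = M & G * (b * b') = D].
Proof.
move=> cab cab' n0 EM ED.
have /coprimezP[[s t] /= E] := cab; have /coprimezP[[s' t'] /= E'] := cab'.
have [x [y [z {}E]]] := bezout_mul E E'.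
exists (x * N + y * M + z * D).
have EN : (x * N + y * M + z * D) * (a * a') = N.
  rewrite 2!mulrDl -!mulrA -EM -ED -[RHS]mulr1 -E; ring.
split=> //; apply: (mulIf n0); rewrite mulrAC EN //.
Qed.

Lemma near_multiple_of_3 q : (1 < q)%N -> ~~ (3 %| q)%N ->
  exists r, (0 < r)%N /\ (q = 3 * r + 1 \/ q = 3 * r - 1)%N.
Proof. by move=> q1 q3; exists ((q + 1) %/ 3)%N; lia. Qed.

Definition abscissa_inv (A B : nat -> int) (n : nat) : rat :=
  (B n)%:~R ^+ 2 / (A n)%:~R.

(* The point at infinity occupies index 0, as (A, B, C) = (1, 0, 1). *)
Record mordell_seq (k : int) (A B C : nat -> int) : Prop := MordellSeq {
  mseq_k_gt0 : 0 < k;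
  mseq_A0 : A 0%N = 1;
  mseq_B0 : B 0%N = 0;
  mseq_A_gt0 : forall n, 0 < A n;
  mseq_B_neq0 : forall n, (0 < n)%N -> B n != 0;
  mseq_coprime : forall n, coprimez (A n) (B n);
  mseq_curve : forall n, A n ^+ 3 = C n ^+ 2 + k * B n ^+ 6;
  mseq_law : forall i j, (j <= i)%N -> xlaw (k%:~R : rat) (abscissa_inv A B) i j }.

Section Sequences.
Variables (k : int) (A B C : nat -> int).
Hypothesis seqABC : mordell_seq k A B C.
Let k_gt0 := mseq_k_gt0 seqABC.
Let A0 := mseq_A0 seqABC.
Let B0 := mseq_B0 seqABC.
Let A_gt0 := mseq_A_gt0 seqABC.
Let B_neq0 := mseq_B_neq0 seqABC.
Let coAB := mseq_coprime seqABC.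
Let curve := mseq_curve seqABC.
Let law := mseq_law seqABC.
Local Notation uval := (abscissa_inv A B).

Definition add_num i j : int := A i ^+ 2 * A j ^+ 2 +
  4 * k * B i ^+ 2 * B j ^+ 2 * (B i ^+ 2 * A j + B j ^+ 2 * A i).
Definition add_mid i j : int := 2 * (A i * A j * (B i ^+ 2 * A j + B j ^+ 2 * A i)
  - 2 * k * B i ^+ 4 * B j ^+ 4).

Lemma A_neq0 n : A n != 0. Proof. by rewrite gt_eqF. Qed.
Lemma Ar_neq0 n : (A n)%:~R != 0 :> rat. Proof. by rewrite intr_eq0 A_neq0. Qed.

Lemma addden_uval i j :
  addden k%:~R (uval i) (uval j) = (add_num i j)%:~R / (A i ^+ 2 * A j ^+ 2)%:~R.
Proof.
have := Ar_neq0 i; have := Ar_neq0 j.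
rewrite /addden /abscissa_inv /add_num => aj ai.
by field; rewrite aj ai.
Qed.

Lemma addsum_uval i j :
  addsum k%:~R (uval i) (uval j) = (add_mid i j)%:~R / (A i ^+ 2 * A j ^+ 2)%:~R.
Proof.
have := Ar_neq0 i; have := Ar_neq0 j.
rewrite /addsum /abscissa_inv /add_mid => aj ai.
by field; rewrite aj ai.
Qed.

Lemma add_num_gt0 i j : 0 < add_num i j.
Proof.
have a0 n : 0 <= A n by apply: ltW.
rewrite /add_num; apply: ltr_pwDl; first by rewrite mulr_gt0 ?exprn_gt0.
have k0 : 0 <= k by apply: ltW.
have b0 n : 0 <= B n ^+ 2 by apply: sqr_ge0.
move: (B i ^+ 2) (B j ^+ 2) (b0 i) (b0 j) => s t s0 t0.
by rewrite !(mulr_ge0, addr_ge0).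
Qed.

(** G is what cancels between the homogeneous addition formulas and lowest terms. Discarding it
    gives the upper parallelogram inequality; controlling its prime factors gives the lower height
    estimate. *)
Lemma add_triple i j : (j <= i)%N -> exists G : int, [/\ 0 < G,
  G * (A (i + j) * A (i - j)) = add_num i j,
  G * (A (i + j) * B (i - j) ^+ 2 + A (i - j) * B (i + j) ^+ 2) = add_mid i j &
  G * (B (i + j) ^+ 2 * B (i - j) ^+ 2) = (B i ^+ 2 * A j - B j ^+ 2 * A i) ^+ 2].
Proof.
move=> /law []; rewrite addden_uval addsum_uval /abscissa_inv.
have ai := Ar_neq0 i; have aj := Ar_neq0 j.
have ap := Ar_neq0 (i + j); have am := Ar_neq0 (i - j).
have aij : (A i ^+ 2 * A j ^+ 2)%:~R != 0 :> rat.
  by rewrite intr_eq0 mulf_neq0 // expf_neq0 // A_neq0.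
move=> S P.
have co n : coprimez (A n) (B n ^+ 2) by apply: coprimezXr.
have n0 : A (i + j) * A (i - j) != 0 by rewrite mulf_neq0 // A_neq0.
have EM : add_num i j * (A (i + j) * B (i - j) ^+ 2 + A (i - j) * B (i + j) ^+ 2) =
    add_mid i j * (A (i + j) * A (i - j)).
  apply: (@intr_inj rat); apply: (mulIf (invr_neq0 aij)).
  rewrite [in RHS]rmorphM [RHS]mulrAC -S.
  rewrite !(rmorphM, rmorphD, rmorphXn) /=.
  by field; rewrite ai aj ap am.
have ED : add_num i j * (B (i + j) ^+ 2 * B (i - j) ^+ 2) =
    (B i ^+ 2 * A j - B j ^+ 2 * A i) ^+ 2 * (A (i + j) * A (i - j)).
  apply: (@intr_inj rat); apply: (mulIf (invr_neq0 aij)).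
  transitivity (((B i)%:~R ^+ 2 / (A i)%:~R - (B j)%:~R ^+ 2 / (A j)%:~R) ^+ 2
    * ((A (i + j))%:~R * (A (i - j))%:~R) : rat).
    by rewrite -P !(rmorphM, rmorphD, rmorphXn) /=; field; rewrite ai aj ap am.
  by field; rewrite ai aj.
have [G [EN' EM' ED']] := coprimez_primitive (co _) (co _) n0 EM ED.
exists G; split => //.
have := add_num_gt0 i j; rewrite -EN' pmulr_lgt0 //.
by rewrite mulr_gt0.
Qed.
Lemma kB_leA n : k * (B n ^+ 2) ^+ 3 <= A n ^+ 3.
Proof. by rewrite curve -exprM lerDr sqr_ge0. Qed.

(** A weighted geometric mean of [kB_leA] at i and j. Cube roots are avoided by comparing B_i^2 /
    A_i with B_j^2 / A_j and using the bound at the larger one. *)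
Lemma kB_mixed i j : k * (B i ^+ 2) ^+ 2 * B j ^+ 2 <= A i ^+ 2 * A j.
Proof.
have := kB_leA i; have := kB_leA j.
have := sqr_ge0 (B i); have := sqr_ge0 (B j); have := A_gt0 i; have := A_gt0 j.
move: (B i ^+ 2) (B j ^+ 2) (A i) (A j) => s t x y y0 x0 t0 s0 ht hs.
have k0 : 0 <= k by apply: ltW.
have [le|le] := leP (t * x) (s * y).
  rewrite -(ler_pM2r x0); apply: (@le_trans _ _ (k * s ^+ 3 * y)).
    have -> : k * s ^+ 2 * t * x = k * s ^+ 2 * (t * x) by ring.
    have -> : k * s ^+ 3 * y = k * s ^+ 2 * (s * y) by ring.
    by rewrite ler_wpM2l // mulr_ge0 ?sqr_ge0.
  have -> : x ^+ 2 * y * x = x ^+ 3 * y by ring.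
  by rewrite ler_pM2r.
have y20 : 0 < y ^+ 2 by rewrite exprn_gt0.
rewrite -(ler_pM2r y20); apply: (@le_trans _ _ (k * t ^+ 3 * x ^+ 2)).
  have -> : k * s ^+ 2 * t * y ^+ 2 = k * t * (s * y) ^+ 2 by ring.
  have -> : k * t ^+ 3 * x ^+ 2 = k * t * (t * x) ^+ 2 by ring.
  rewrite ler_wpM2l // ?mulr_ge0 // lerXn2r ?nnegrE ?mulr_ge0 // ltW //.
have -> : x ^+ 2 * y * y ^+ 2 = y ^+ 3 * x ^+ 2 by ring.
by rewrite ler_pM2r // exprn_gt0.
Qed.

Lemma add_num_le i j : add_num i j <= 9 * (A i ^+ 2 * A j ^+ 2).
Proof.
have h1 := kB_mixed i j; have h2 := kB_mixed j i.
have -> : add_num i j = A i ^+ 2 * A j ^+ 2 +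
  4 * (k * (B i ^+ 2) ^+ 2 * B j ^+ 2 * A j) + 4 * (k * (B j ^+ 2) ^+ 2 * B i ^+ 2 * A i).
  by rewrite /add_num; ring.
have {}h1 : k * (B i ^+ 2) ^+ 2 * B j ^+ 2 * A j <= A i ^+ 2 * A j ^+ 2.
  by rewrite [A j ^+ 2]expr2 mulrA ler_pM2r.
have {}h2 : k * (B j ^+ 2) ^+ 2 * B i ^+ 2 * A i <= A i ^+ 2 * A j ^+ 2.
  by rewrite (_ : A i ^+ 2 * _ = A j ^+ 2 * A i * A i) ?ler_pM2r //; ring.
move: (A i ^+ 2 * A j ^+ 2) (_ * A i) (_ * A j) h1 h2 => x y z; lra.
Qed.

Lemma numer_parallelogram i j : (j <= i)%N ->
  A (i + j) * A (i - j) <= 9 * (A i ^+ 2 * A j ^+ 2).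
Proof.
move=> /add_triple [G [G0 EN _ _]]; apply: le_trans (add_num_le i j).
rewrite -EN ler_peMl ?mulr_ge0 ?(ltW (A_gt0 _)) //.
Qed.

Lemma doubling n : exists G : int, [/\ 0 < G,
  G * A (n + n) = A n * (A n ^+ 3 + 8 * k * B n ^+ 6) &
  G * B (n + n) ^+ 2 = 4 * B n ^+ 2 * C n ^+ 2].
Proof.
have [G [G0 EN EM _]] := add_triple (leqnn n).
rewrite subnn A0 B0 in EN EM; exists G; split => //.
  by rewrite mulr1 in EN; rewrite EN /add_num; ring.
have -> : C n ^+ 2 = A n ^+ 3 - k * B n ^+ 6 by rewrite curve addrK.
rewrite expr0n mulr0 add0r mul1r in EM; rewrite EM /add_mid; ring.
Qed.

(** * Reduction at a single prime *)

Section Prime.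
Variable p : nat.
Hypothesis p_pr : prime p.

Lemma add_num_mod i j : (p %| k * B i ^+ 2)%Z ->
  (p %| add_num i j)%Z = (p %| A i)%Z || (p %| A j)%Z.
Proof.
move=> h; have -> : add_num i j = A i ^+ 2 * A j ^+ 2 +
    k * B i ^+ 2 * (4 * B j ^+ 2 * (B i ^+ 2 * A j + B j ^+ 2 * A i)).
  by rewrite /add_num; ring.
rewrite rpredDr; last by apply: dvdz_mulr.
by rewrite prime_dvdzM // !prime_dvdzX // !andbT.
Qed.

Lemma kernel_ndvd n : (p %| B n)%Z -> ~~ (p %| A n)%Z.
Proof.
move=> pb; apply/negP => pa; have := coAB n.
rewrite coprimezE => /eqP g1; have : (p %| gcdn `|A n| `|B n|)%N by rewrite dvdn_gcd; apply/andP.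
by rewrite g1 Euclid_dvd1.
Qed.

(** Modulo p the curve is the cusp y^2 = x^3 with singular point x = 0, and its nonsingular points
    form a group; here this amounts to [add_num i j] being congruent to (A_i A_j)^2. *)
Lemma singular_closed s i : (p %| k)%Z -> ~~ (p %| A i)%Z -> ~~ (p %| A (s * i)%N)%Z.
Proof.
move=> pk pi; elim: s => [|s IH]; first by rewrite mul0n A0 ndvdz1.
have [G [_ EN _ _]] : exists G, [/\ 0 < G, G * (A (s * i + i) * A (maxn (s * i) i - minn (s * i) i))
    = add_num (s * i) i, True & True].
  case: (leqP i (s * i)) => h; [have := add_triple h | have := add_triple (ltnW h)] => -[G [G0 EN _ _]].
    by exists G; split=> //.
  by exists G; split=> //; rewrite addnC EN /add_num; ring.
rewrite mulSn addnC; apply/negP => h.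
have : (p %| add_num (s * i) i)%Z by rewrite -EN dvdz_mull // dvdz_mulr.
by rewrite add_num_mod ?dvdz_mulr // (negPf IH) (negPf pi).
Qed.

(** p dividing B_n means that nQ reduces to infinity. Then [add_num] is prime to p, nothing cancels
    at p, and the sum and product of u(i+j), u(i-j) both vanish modulo p. *)
Lemma kernel_addsub i j : (j <= i)%N -> (p %| B i)%Z -> (p %| B j)%Z ->
  (p %| B (i + j)%N)%Z && (p %| B (i - j)%N)%Z.
Proof.
move=> /add_triple [G [G0 EN EM ED]] pi pj.
have pG : ~~ (p %| G)%Z.
  apply/negP => pG; have : (p %| add_num i j)%Z by rewrite -EN dvdz_mulr.
  rewrite add_num_mod; last by apply: dvdz_mull; rewrite expr2 dvdz_mulr.
  by rewrite (negPf (kernel_ndvd pi)) (negPf (kernel_ndvd pj)).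
have pM : (p %| A (i + j) * B (i - j) ^+ 2 + A (i - j) * B (i + j) ^+ 2)%Z.
  have : (p %| add_mid i j)%Z.
    rewrite /add_mid dvdz_mull // rpredB //.
      by rewrite dvdz_mull // rpredD // dvdz_mulr // expr2 dvdz_mulr.
    by rewrite dvdz_mull // exprS dvdz_mulr.
  by rewrite -EM prime_dvdzM // (negPf pG).
have pD : (p %| B (i + j) ^+ 2 * B (i - j) ^+ 2)%Z.
  have : (p %| (B i ^+ 2 * A j - B j ^+ 2 * A i) ^+ 2)%Z.
    by rewrite prime_dvdzX // andbT rpredB // dvdz_mulr // expr2 dvdz_mulr.
  by rewrite -ED prime_dvdzM // (negPf pG).
move: pD; rewrite prime_dvdzM // !prime_dvdzX // !andbT => /orP [] h; rewrite h /= ?andbT.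
  move: pM; rewrite rpredDr; last by rewrite expr2 mulrA dvdz_mull.
  by rewrite prime_dvdzM // (negPf (kernel_ndvd h)) prime_dvdzX // andbT.
move: pM; rewrite rpredDl; last by rewrite expr2 mulrA dvdz_mull.
by rewrite prime_dvdzM // (negPf (kernel_ndvd h)) prime_dvdzX // andbT.
Qed.

(** If iQ reduces to infinity, then (i+j)Q and (i-j)Q reduce to jQ up to sign. *)
Lemma kernel_translate i j : (j <= i)%N -> (p %| B i)%Z ->
  (p %| A (i + j)%N)%Z || (p %| A (i - j)%N)%Z -> (p %| A j)%Z.
Proof.
move=> /add_triple [G [G0 EN _ _]] pi h.
have pN : (p %| add_num i j)%Z.
  by rewrite -EN dvdz_mull // prime_dvdzM.
move: pN; rewrite add_num_mod ?(negPf (kernel_ndvd pi)) //.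
by apply: dvdz_mull; rewrite expr2 dvdz_mulr.
Qed.

Lemma uval_gt0 n : (0 < n)%N -> 0 < uval n.
Proof.
move=> /B_neq0 b0; rewrite /abscissa_inv divr_gt0 ?ltr0z //.
by rewrite exprn_even_gt0 //= intr_eq0.
Qed.

Lemma uval0 : uval 0 = 0.
Proof. by rewrite /abscissa_inv B0 expr0n mul0r. Qed.

Lemma kr_gt0 : 0 < k%:~R :> rat. Proof. by rewrite ltr0z. Qed.

(* Denominator of the triplication formula at nP, where r stands for A_n^3 / k. *)
Definition tripling_den n (r : rat) : rat :=
  r ^+ 3 + 96 * (B n)%:~R ^+ 6 * r ^+ 2 + 48 * (B n)%:~R ^+ 12 * r - 64 * (B n)%:~R ^+ 18.

(** Duplication gives u(2n); the product law at (2n, n), where the difference is n again, then gives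
    u(3n) without any ordinate. *)
Lemma tripling n : (0 < n)%N -> let r : rat := (A n)%:~R ^+ 3 / k%:~R in
  k%:~R * uval (3 * n) * tripling_den n r =
  (A n)%:~R ^+ 2 * (9 * (B n)%:~R ^+ 2 * (r - 4 * (B n)%:~R ^+ 6) ^+ 2).
Proof.
move=> n0 r; have [S2 _] := law (leqnn n).
have nn : (n <= n + n)%N by rewrite leq_addr.
have [_ P3] := law nn.
rewrite subnn uval0 addr0 in S2; rewrite addnK in P3.
have -> : (3 * n = n + n + n)%N by rewrite !mulSn addn0 addnA.
have a0 : (A n)%:~R != 0 :> rat := Ar_neq0 n.
have k0 : k%:~R != 0 :> rat by rewrite gt_eqF // kr_gt0.
have b0 : (B n)%:~R != 0 :> rat by rewrite intr_eq0 B_neq0.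
have u0 := uval_gt0 n0; have u0' : uval n != 0 by rewrite gt_eqF.
have d0 : 1 + 8 * k%:~R * uval n ^+ 3 != 0.
  have := mulr_gt0 kr_gt0 (exprn_gt0 3 u0).
  by rewrite -mulrA; move: (k%:~R * _) => z z0; apply: lt0r_neq0; lra.
have {S2} E2 : uval (n + n) = 4 * uval n * (1 - k%:~R * uval n ^+ 3) / (1 + 8 * k%:~R * uval n ^+ 3).
  apply: (canRL (mulfK d0)); move: S2; rewrite /addden /addsum => S2.
  transitivity (uval (n + n) * (1 + 4 * k%:~R * uval n * uval n * (uval n + uval n))).
    by ring.
  by rewrite S2; ring.
have : uval (n + n + n) * (1 + 96 * (k%:~R * uval n ^+ 3) + 48 * (k%:~R * uval n ^+ 3) ^+ 2
    - 64 * (k%:~R * uval n ^+ 3) ^+ 3) = 9 * uval n * (1 - 4 * (k%:~R * uval n ^+ 3)) ^+ 2.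
  apply: (mulIf (mulf_neq0 u0' (invr_neq0 (expf_neq0 2 d0)))).
  transitivity (uval (n + n + n) * uval n * addden k%:~R (uval (n + n)) (uval n)).
    rewrite E2 /addden; move: (uval n) (uval (n + n + n)) u0' d0 => x y x0 d0; field.
    by rewrite d0.
  rewrite P3 E2; move: (uval n) u0' d0 => x x0 d0; field.
  by rewrite d0.
rewrite {2 3 4 5 6}/abscissa_inv /tripling_den /r; move: (uval (n + n + n)) => y E.
move/(congr1 (fun z => z * (k%:~R * ((A n)%:~R ^+ 9 / k%:~R ^+ 3)))): E => E.
apply: etrans; last (apply: etrans; first exact: E).
  by field; rewrite k0 a0.
by field; rewrite k0 a0.
Qed.

(** * Primes p >= 5 and the cube-free parameter *)

Variable m : int.
Hypotheses (p_gt4 : (4 < p)%N) (m_neq0 : m != 0) (kE : k = 432 * m ^+ 2).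
Hypothesis m_cube_free : ~~ (p%:Z ^+ 3 %| m)%Z.

Lemma ndvd_small n : (0 < n < 5)%N -> ~~ (p %| n)%N.
Proof.
by move=> /andP[n0 n5]; apply/negP => /(dvdn_leq n0); rewrite leqNgt (leq_trans n5).
Qed.

Lemma punit432 : padic_unit p (432 : rat).
Proof.
have -> : (432 : rat) = 2%:R ^+ 4 * 3%:R ^+ 3 by ring.
by apply: punitM => //; apply: punitX => //; apply: punit_nat => //; apply: ndvd_small.
Qed.

(** This is v_p(A_n) >= v_p(m), where v_p(m) <= 2. Only v_p(m) = 2 needs an argument: with v_p(A_n)
    = 1 the curve equation would give C_n^2 the odd valuation 3. *)
Lemma numer_div_m n : (p %| A n)%Z -> padic p 0 ((A n)%:~R / m%:~R).
Proof.
move=> pA.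
have pB : ~~ (p %| B n)%Z by apply: contraL pA; apply: kernel_ndvd.
have [/dvdzP[m1 mE]|pm] := boolP (p %| m)%Z; last first.
  by exists (A n), m; rewrite expr0 mul1r.
have p0 : p%:Z != 0 by case: (p) p_pr.
have pr0 : p%:~R != 0 :> rat by rewrite intr_eq0.
have [/dvdzP[m2 m1E]|pm1] := boolP (p %| m1)%Z; last first.
  move/dvdzP: pA => [a aE]; exists a, m1; split => //.
  by rewrite aE mE expr0 mul1r !rmorphM /=; field; rewrite pr0 (ndvdz_neq0 pm1).
have pm2 : ~~ (p %| m2)%Z.
  apply/negP => /dvdzP[m3 m2E]; move/negP: m_cube_free; apply; apply/dvdzP.
  by exists m3; rewrite mE m1E m2E; ring.
suff : (p%:Z ^+ 2 %| A n)%Z.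
  move=> /dvdzP[a aE]; exists a, m2; split => //.
  rewrite aE mE m1E expr0 mul1r !rmorphM /=.
  by field; rewrite pr0 (ndvdz_neq0 pm2).
move/dvdzP: pA => [a aE].
have := curve n; rewrite kE mE m1E aE => E.
have /dvdzP[c cE] : (p %| C n)%Z.
  have : (p %| C n ^+ 2)%Z.
    have -> : C n ^+ 2 = p%:Z * (p%:Z ^+ 2 * a ^+ 3 - 432 * (m2 ^+ 2 * p%:Z ^+ 3) * B n ^+ 6).
      by apply: (addIr (432 * (m2 * p * p) ^+ 2 * B n ^+ 6)); rewrite -E; ring.
    exact: dvdz_mulr.
  by rewrite prime_dvdzX // andbT.
have {}E : p%:Z * a ^+ 3 = c ^+ 2 + p%:Z ^+ 2 * (432 * m2 ^+ 2 * B n ^+ 6).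
  apply: (mulfI (expf_neq0 2 p0)).
  transitivity ((a * p) ^+ 3); first by ring.
  by rewrite E cE; ring.
have /dvdzP[d dE] : (p %| c)%Z.
  have : (p %| c ^+ 2)%Z.
    have -> : c ^+ 2 = p%:Z * (a ^+ 3 - p%:Z * (432 * m2 ^+ 2 * B n ^+ 6)).
      by apply: (addIr (p%:Z ^+ 2 * (432 * m2 ^+ 2 * B n ^+ 6))); rewrite -E; ring.
    exact: dvdz_mulr.
  by rewrite prime_dvdzX // andbT.
have : (p %| a ^+ 3)%Z.
  have -> : a ^+ 3 = p%:Z * (d ^+ 2 + (432 * m2 ^+ 2 * B n ^+ 6)).
    by apply: (mulfI p0); rewrite E dE; ring.
  exact: dvdz_mulr.
rewrite prime_dvdzX // andbT => /dvdzP[e eE].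
by apply/dvdzP; exists e; rewrite eE; ring.
Qed.

(* A_n^3 / k measures the p-adic distance of nQ to the 3-torsion points (0, y). *)
Lemma numer_cube_near n : (p %| A n)%Z -> padic p 1 ((A n)%:~R ^+ 3 / k%:~R).
Proof.
move=> pA; have hd := numer_div_m pA.
have -> : (A n)%:~R ^+ 3 / k%:~R = (A n)%:~R * (((A n)%:~R / m%:~R) ^+ 2 * 432^-1) :> rat.
  by rewrite kE rmorphM rmorphXn /=; field; rewrite intr_eq0.
apply: padicM0 => //; first by apply: padic_dvd; rewrite ?expr1.
apply: padicM0 => //; first exact: padic0X.
by apply: punit_padic; apply: punitV; exact: punit432.
Qed.

(** Modulo p the quotient r = A_n^3 / k vanishes, so the two factors of the triplication formula
    reduce to 144 B_n^14 and -64 B_n^18, which are units. *)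
Lemma uval_triple n : (0 < n)%N -> (p %| A n)%Z ->
  exists2 e, padic_unit p e & k%:~R * uval (3 * n) = (A n)%:~R ^+ 2 * e.
Proof.
move=> n0 pA; have r1 := numer_cube_near pA.
have pB : ~~ (p %| B n)%Z by apply: contraL pA; apply: kernel_ndvd.
have uB : padic_unit p (B n)%:~R by apply: punit_int.
have := tripling n0; rewrite /=; set r := _ / _ in r1 *.
have r0 : padic p 0 r by apply: padicW r1.
have u3 : padic_unit p 3%:R by apply: punit_nat => //; apply: ndvd_small.
have u2 : padic_unit p 2%:R by apply: punit_nat => //; apply: ndvd_small.
have u4 : padic_unit p 4 by rewrite (_ : 4 = 2%:R ^+ 2) //; apply: punitX.
have ud : padic_unit p (tripling_den n r).
  have -> : tripling_den n r = - ((2%:R ^+ 3 * (B n)%:~R ^+ 9) ^+ 2)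
      + r * (r ^+ 2 + 96 * (B n)%:~R ^+ 6 * r + 48 * (B n)%:~R ^+ 12).
    by rewrite /tripling_den; ring.
  apply: punitD => //.
    rewrite -mulN1r; apply: punitM => //; last by apply: punitX => //; apply: punitM => //; apply: punitX.
    by exists (-1), 1; rewrite rpredN ndvdz1 //=; split=> //; rewrite divr1.
  apply: padicM0 => //; have b0 := punit_padic uB.
  apply: padicD => //; last by apply: padic0M => //; [apply: padic_nat | apply: padic0X].
  apply: padicD => //; first by apply: padic0X.
  by apply: padic0M => //; apply: padic0M => //; [apply: padic_nat | apply: padic0X].
have un : padic_unit p (9 * (B n)%:~R ^+ 2 * (r - 4 * (B n)%:~R ^+ 6) ^+ 2).
  have -> : 9 * (B n)%:~R ^+ 2 * (r - 4 * (B n)%:~R ^+ 6) ^+ 2 =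
      3%:R ^+ 2 * (B n)%:~R ^+ 2 * (4 * (B n)%:~R ^+ 6 + - r) ^+ 2 by ring.
  apply: punitM => //; first by apply: punitM => //; apply: punitX.
  apply: punitX => //; apply: punitD => //; last exact: padicN.
  by apply: punitM => //; apply: punitX.
move=> E; exists (9 * (B n)%:~R ^+ 2 * (r - 4 * (B n)%:~R ^+ 6) ^+ 2 / tripling_den n r).
  by apply: punitM => //; apply: punitV.
by rewrite [RHS]mulrA -E mulfK // (punit_neq0 ud).
Qed.

Lemma dvdz_logn e n : (p%:Z ^+ e %| A n)%Z = (e <= logn p `|A n|)%N.
Proof. by rewrite dvdzE abszX /= pfactor_dvdn // absz_gt0 A_neq0. Qed.

(** The ratio u(3qn) / u(3n) is the square of A_(qn) / A_n times a unit. Its valuation is that of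
    q^2, because k u(3n)^3 is the square of A_n^3 / k times a unit, hence divisible by p^2. *)
Lemma logn_numer_step n q : (0 < n)%N -> prime q -> (p %| A n)%Z ->
  (p %| A (q * n)%N)%Z -> (logn p `|A (q * n)%N| <= logn p `|A n| + (p == q))%N.
Proof.
move=> n0 q_pr pA pAq; have qn0 : (0 < q * n)%N by rewrite muln_gt0 prime_gt0.
have k0 : k%:~R != 0 :> rat by rewrite gt_eqF // kr_gt0.
have [e ue eE] := uval_triple n0 pA; have [e' ue' eE'] := uval_triple qn0 pAq.
set l := (3 * n)%N in eE; have lE : (3 * (q * n) = q * l)%N by rewrite /l mulnCA.
rewrite lE in eE'; have l0 : (0 < l)%N by rewrite muln_gt0.
have ul0 : uval l != 0 by rewrite gt_eqF // uval_gt0.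
pose t j := uval (j * l) / uval l.
have w2 : padic p 2 (k%:~R * uval l ^+ 3).
  have -> : k%:~R * uval l ^+ 3 = (k%:~R * uval l) ^+ 3 / k%:~R ^+ 2 by field.
  have -> : (k%:~R * uval l) ^+ 3 / k%:~R ^+ 2 = ((A n)%:~R ^+ 3 / k%:~R) ^+ 2 * e ^+ 3.
    by rewrite eE; field.
  apply: padicM0 => //; last by apply: padic0X => //; apply: punit_padic.
  exact: (padicX p_pr 2 (numer_cube_near pA)).
have t0 : t 0%N = 0 by rewrite /t mul0n uval0 mul0r.
have t1 : t 1%N = 1 by rewrite /t mul1n divff.
have tSS j : (t j.+2 + t j) * (1 + 4 * (k%:~R * uval l ^+ 3) * t j.+1 * (t j.+1 + 1)) =
    2 * (t j.+1 + 1 - 2 * (k%:~R * uval l ^+ 3) * t j.+1 ^+ 2).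
  have lj : (l <= j.+1 * l)%N by rewrite leq_pmull.
  have [S _] := law lj; rewrite addnC -mulSn mulSn addKn in S.
  apply: (mulIf ul0); rewrite /t; move: S; rewrite /addden /addsum mulSn.
  move: (uval (j.+2 * l)) (uval (j * l)) (uval (l + j * l)) (uval l) ul0 => x y z u u0 S.
  transitivity ((x + y) * (1 + 4 * k%:~R * z * u * (z + u))); first by field.
  by rewrite S; field.
rewrite leqNgt -addnS; apply/negP; rewrite -dvdz_logn => h.
apply: (padic_mul_prime p_pr w2 t0 t1 tSS q_pr).
set d : nat := p == q in h *; set a := logn _ _ in h.
have ar0 : (A n)%:~R != 0 :> rat := Ar_neq0 n.
have -> : t q = ((A (q * n)%N)%:~R / (A n)%:~R) ^+ 2 * (e' / e).
  rewrite /t; have e0 := punit_neq0 ue.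
  have -> : uval (q * l) = (A (q * n)%N)%:~R ^+ 2 * e' / k%:~R by rewrite -eE'; field.
  have -> : uval l = (A n)%:~R ^+ 2 * e / k%:~R by rewrite -eE; field.
  by field; rewrite e0 k0 ar0.
apply: padicM0 => //; last by apply: punit_padic; apply: punitM => //; apply: punitV.
(* An excess of d + 1 in A gives t_q the valuation 2 (d + 1) or more, beyond the excluded 1 + 2
   d. *)
apply: (@padicW _ (2 * d.+1)); first by clear; lia.
apply: padicX => //.
have /dvdzP[x xE] := h.
have /dvdzP[y yE] : (p%:Z ^+ a %| A n)%Z by rewrite dvdz_logn.
have py : ~~ (p %| y)%Z.
  apply/negP => /dvdzP[z zE]; have := ltnn a; rewrite -{2}/a -[(a < _)%N]dvdz_logn.
  by rewrite yE zE -mulrA -exprS dvdz_mull.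
exists x, y; split => //.
have p0 : p%:~R != 0 :> rat by rewrite intr_eq0; case: (p) p_pr.
rewrite xE yE exprD !rmorphM /= !rmorphXn /=; field.
by rewrite (ndvdz_neq0 py) expf_neq0.
Qed.

Lemma kernel_mul s i : (p %| B i)%Z -> (p %| B (s * i)%N)%Z.
Proof.
move=> pi; elim: s => [|s IH]; first by rewrite mul0n B0 dvdz0.
rewrite mulSn; case: (leqP (s * i) i) => h.
  by have /andP[] := kernel_addsub h pi IH.
by have /andP[] := kernel_addsub (ltnW h) IH pi; rewrite addnC.
Qed.

Lemma kernel_gcd i j : (p %| B i)%Z -> (p %| B j)%Z -> (p %| B (gcdn i j))%Z.
Proof.
have [N] := ubnP (i + j); elim: N i j => // N IH i j.
wlog ij : i j / (j <= i)%N => [hw|].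
  case: (leqP j i) => [/hw //|/ltnW ji h pi pj].
  by rewrite gcdnC; apply: hw; rewrite // addnC.
have [->|j0] := posnP j; first by rewrite gcdn0.
move=> h pi pj; have /andP[_ pij] := kernel_addsub ij pi pj.
have -> : gcdn i j = gcdn (i - j) j by rewrite gcdnC -{1}(subnK ij) gcdnDr gcdnC.
by apply: IH => //; clear -h j0 ij; lia.
Qed.

Lemma kernel_triple n : (0 < n)%N -> ~~ (p %| k)%Z -> (p %| A n)%Z -> (p %| B (3 * n)%N)%Z.
Proof.
move=> n0 pk pA; have [e ue E] := uval_triple n0 pA.
have pk2 : padic_unit p k%:~R by apply: punit_int.
have h : padic p 2 (uval (3 * n)).
  apply: (padic_divu p_pr pk2); rewrite mulrC E; apply: padicM0 => //; last exact: punit_padic.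
  by apply: (padicX p_pr 2 (e := 1)); apply: padic_dvd; rewrite ?expr1.
have : padic p 2 ((B (3 * n)%N ^+ 2)%:~R).
  have -> : (B (3 * n)%N ^+ 2)%:~R = uval (3 * n) * (A (3 * n)%N)%:~R.
    by rewrite /abscissa_inv divfK ?Ar_neq0 // rmorphXn.
  by apply: padicM0 => //; apply: padic_int.
move/(@padicW p 2 1 _ isT)/(dvd_padic p_pr).
by rewrite expr1 prime_dvdzX // andbT.
Qed.

(** For cube-free m the component group at p has order 1 or 3, so 3nQ is nonsingular. Concretely,
    v_p(A_n) >= v_p(m) makes u(3n) p-integral, and then p cannot divide its reduced denominator
    A_(3n). *)
Lemma numer_triple_ndvd n : (0 < n)%N -> (p %| k)%Z -> ~~ (p %| A (3 * n)%N)%Z.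
Proof.
move=> n0 pk; have [pn|pn] := boolP (p %| A n)%Z; last exact: singular_closed.
have [e ue E] := uval_triple n0 pn.
have hA : padic p 0 ((A n)%:~R ^+ 2 / k%:~R).
  have -> : (A n)%:~R ^+ 2 / k%:~R = ((A n)%:~R / m%:~R) ^+ 2 * 432^-1 :> rat.
    by rewrite kE rmorphM rmorphXn /=; field; rewrite intr_eq0.
  apply: padicM0 => //; first by apply: padic0X => //; apply: numer_div_m.
  by apply: punit_padic; apply: punitV; apply: punit432.
have k0 : k%:~R != 0 :> rat by rewrite gt_eqF // kr_gt0.
have hu : padic p 0 (uval (3 * n)).
  have -> : uval (3 * n) = (A n)%:~R ^+ 2 / k%:~R * e.
    by apply: (mulfI k0); rewrite E; field.
  by apply: padicM0 => //; apply: punit_padic.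
apply/negP => pn3; have : padic p 1 ((B (3 * n)%N ^+ 2)%:~R).
  have -> : (B (3 * n)%N ^+ 2)%:~R = uval (3 * n) * (A (3 * n)%N)%:~R.
    by rewrite /abscissa_inv divfK ?Ar_neq0 // rmorphXn.
  by apply: padic0M => //; apply: padic_dvd; rewrite ?expr1.
move/(dvd_padic p_pr); rewrite expr1 prime_dvdzX // andbT => pB.
by move: (kernel_ndvd pB); rewrite pn3.
Qed.

(** If p divides k, any prime factor q of n serves, and 3 is not among them. Otherwise 3gQ reduces
    to infinity for g = gcd(n, i), and writing q = 3r + 1 or 3r - 1 makes n a multiple of 3(n/q)
    plus or minus n/q. *)
Lemma numer_rank n i : (0 < i < n)%N -> (p %| A n)%Z -> (p %| A i)%Z ->
  exists q, [/\ prime q, q != 3%N, (q %| n)%N & (p %| A (n %/ q)%N)%Z].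
Proof.
move=> /andP[i0 lin] pn pi; have n0 : (0 < n)%N by apply: leq_trans lin.
have [pk|pk] := boolP (p %| k)%Z.
  have n3 : ~~ (3 %| n)%N.
    apply/negP => /dvdnP[s nE]; rewrite mulnC in nE.
    have s0 : (0 < s)%N by move: n0; rewrite nE; case: (s).
    by move: (numer_triple_ndvd s0 pk); rewrite -nE pn.
  exists (pdiv n); have q_pr : prime (pdiv n) by rewrite pdiv_prime // (leq_ltn_trans i0).
  split => //; first by apply: contraNneq n3 => <-; apply: pdiv_dvd.
    exact: pdiv_dvd.
  apply/negPn/negP => h; move: (singular_closed (pdiv n) pk h).
  by rewrite mulnC divnK ?pdiv_dvd // pn.
have pB : ~~ (p %| B n)%Z by apply: contraL pn; apply: kernel_ndvd.
pose g := gcdn n i; have g0 : (0 < g)%N by rewrite gcdn_gt0 n0.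
have pg : (p %| B (3 * g)%N)%Z.
  by rewrite /g muln_gcdr; apply: kernel_gcd; apply: kernel_triple.
have gn : (g %| n)%N by apply: dvdn_gcdl.
have ng : (1 < n %/ g)%N.
  rewrite ltn_divRL // mul1n; apply: leq_ltn_trans lin; exact: dvdn_leq (dvdn_gcdr _ _).
(* Otherwise n is a multiple of 3g and nQ reduces to infinity. *)
have n3 : ~~ (3 %| n %/ g)%N.
  apply: contra pB => /dvdnP[s sE]; rewrite -(divnK gn) sE -mulnA.
  exact: kernel_mul.
have q_pr := pdiv_prime ng; set q := pdiv _ in q_pr.
have qn : (q %| n %/ g)%N by apply: pdiv_dvd.
have q3 : q != 3%N by apply: contraNneq n3 => <-.
have qdn : (q %| n)%N by apply: dvdn_trans qn _; rewrite -{2}(divnK gn) dvdn_mulr.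
exists q; split => //.
have nE : (n = q * (n %/ q))%N by rewrite mulnC divnK.
have /dvdnP[s sE] : (g %| n %/ q)%N.
  move/dvdnP: qn => [s sE]; apply/dvdnP; exists s.
  by rewrite -{1}(divnK gn) sE mulnAC mulnK // prime_gt0.
have pq : (p %| B (3 * (n %/ q))%N)%Z.
  by rewrite sE mulnCA; apply: kernel_mul.
have q3' : ~~ (3 %| q)%N by rewrite dvdn_prime2 // eq_sym.
have q2 : (1 < q)%N by apply: prime_gt1.
have [r [r0 hr]] := near_multiple_of_3 q2 q3'.
have ps := kernel_mul r pq.
have le : (n %/ q <= r * (3 * (n %/ q)))%N by rewrite mulnA leq_pmull // muln_gt0 r0.
apply: (kernel_translate le ps).
suff : ((n == r * (3 * (n %/ q)) + n %/ q) || (n == r * (3 * (n %/ q)) - n %/ q))%N.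
  by case/orP => /eqP <-; rewrite pn ?orbT.
move: nE; set x := (n %/ q)%N => ->; rewrite mulnA [(r * 3)%N]mulnC; clearbody x.
case: hr => ->; first by rewrite mulnDl mul1n eqxx.
by rewrite mulnBl mul1n eqxx orbT.
Qed.

Lemma logn_numer_le n i : (0 < i < n)%N -> (p %| A n)%Z -> (p %| A i)%Z ->
  exists q, [/\ prime q, q != 3%N, (q %| n)%N &
    (logn p `|A n| <= logn p `|A (n %/ q)%N| + logn p n)%N].
Proof.
move=> hin pn pi; have [q [q_pr q3 qn pq]] := numer_rank hin pn pi.
have n0 : (0 < n)%N by case: (n) hin; rewrite ?ltn0 ?andbF.
exists q; split => //.
have nq0 : (0 < n %/ q)%N by rewrite divn_gt0 ?prime_gt0 // dvdn_leq.
have nE : (n = q * (n %/ q))%N by rewrite mulnC divnK.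
rewrite nE in pn; have := logn_numer_step nq0 q_pr pq pn.
rewrite -nE => /leq_trans; apply.
rewrite leq_add2l; case: eqP => // ->.
by rewrite -pfactor_dvdn // expn1.
Qed.

End Prime.
End Sequences.

(** * Parts prime to 6 *)

Definition big_primes : nat_pred := [pred p : nat | (4 < p)%N].
Definition part6 (x : int) : nat := (`|x|%N`_big_primes)%N.

Lemma logn_partn (pi : nat_pred) p n : p \in pi -> logn p n`_pi = logn p n.
Proof.
move=> ppi; rewrite -[LHS]logn_part partn_part ?logn_part // => q.
by rewrite inE => /eqP ->.
Qed.

Lemma part_dvd_logn (pi : nat_pred) (x y : nat) : (0 < y)%N ->
  (forall p, prime p -> p \in pi -> (p %| x)%N -> (logn p x <= logn p y)%N) ->
  (x`_pi %| y)%N.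
Proof.
move=> y0 h; apply/dvdn_partP => // p.
rewrite mem_primes => /and3P[p_pr _ px].
have ppi : p \in pi by apply: (pnatPpi (part_pnat pi x)); rewrite mem_primes p_pr part_gt0.
rewrite p_part logn_partn // pfactor_dvdn //; apply: h => //.
by apply: dvdn_trans px (dvdn_part _ _).
Qed.

Lemma big_primesP p : prime p -> p \in big_primes^' -> p = 2%N \/ p = 3%N.
Proof. by move=> p_pr; rewrite !inE -leqNgt; case: p p_pr => [|[|[|[|[|]]]]] //; auto. Qed.

Lemma prime_dvdzMX p a b n : prime p -> (0 < n)%N ->
  (p %| a * b ^+ n)%Z = (p %| a)%Z || (p %| b)%Z.
Proof. by move=> p_pr n0; rewrite prime_dvdzM // prime_dvdzX // n0 andbT. Qed.

Lemma big_ndvdz p n : prime p -> (4 < p)%N -> (0 < n < 5)%N -> ~~ (p %| n%:Z)%Z.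
Proof. by move=> p_pr p4 n5; apply: ndvd_small. Qed.

Section CubeFreeSeq.
Variables (k m : int) (A B C : nat -> int).
Hypothesis seqABC : mordell_seq k A B C.
Hypotheses (m_neq0 : m != 0) (kE : k = 432 * m ^+ 2).
Hypothesis m_cube_free : forall p, prime p -> ~~ (p%:Z ^+ 3 %| m)%Z.

Let A_gt0 := mseq_A_gt0 seqABC.

Lemma absA n : (`|A n|%N)%:Z = A n. Proof. by rewrite gez0_abs // ltW. Qed.
Lemma absA_gt0 n : (0 < `|A n|)%N. Proof. by rewrite absz_gt0 gt_eqF. Qed.

Lemma prime_big_dvd_k p : prime p -> (4 < p)%N -> (p %| k)%Z = (p %| m)%Z.
Proof.
move=> p_pr p4; rewrite kE (_ : 432 = 2%:Z ^+ 4 * 3%:Z ^+ 3) // !prime_dvdzMX //.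
by rewrite prime_dvdzX // (negPf (@big_ndvdz p 2 _ _ _)) // (negPf (@big_ndvdz p 3 _ _ _)).
Qed.

Lemma curve432 n : A n ^+ 3 = C n ^+ 2 + 432 * m ^+ 2 * B n ^+ 6.
Proof. by rewrite -kE; apply: (mseq_curve seqABC). Qed.

Lemma cofactor6 n : exists d, [/\ `|A n|%N = (d * part6 (A n))%N, (d %| 36)%N &
  (9 %| d)%N -> (9 %| m)%Z].
Proof.
have m8 := m_cube_free (isT : prime 2); have m27 := m_cube_free (isT : prime 3).
have [l2 _] := logn2_numer (mseq_coprime seqABC n) (curve432 n) m8.
have [l3 h9 _] := logn3_numer (mseq_coprime seqABC n) (curve432 n) m27.
exists (`|A n|%N`_big_primes^')%N; split.
- by rewrite mulnC partnC // absA_gt0.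
- apply: part_dvd_logn => // p p_pr /(big_primesP p_pr) [] -> _ //.
- by move=> d9; apply: h9; rewrite -(pfactor_dvdn 2) ?absA_gt0 // (dvdn_trans d9) ?dvdn_part.
Qed.

Lemma absA_le_part6 n : (`|A n| <= 36 * part6 (A n))%N.
Proof. by have [d [-> /dvdn_leq d36 _]] := cofactor6 n; rewrite leq_mul2r d36 ?orbT. Qed.

(** A_n^3 / k - B_n^6 is a unit at p, so C_n^2 has exactly the valuation of k, and G divides 4 B_n^2
    C_n^2. If p did not divide A_n, it would divide A_n^3 + 8 k B_n^6 and C_n^2, hence 9 k B_n^6,
    which leads back to A_n. *)
Lemma gcd_doubling_prime n (G : int) p : prime p -> (4 < p)%N -> 0 < G ->
  G * A (n + n) = A n * (A n ^+ 3 + 8 * k * B n ^+ 6) ->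
  G * B (n + n) ^+ 2 = 4 * B n ^+ 2 * C n ^+ 2 -> (p %| G)%Z ->
  [/\ (p %| A n)%Z, (p %| m)%Z & (logn p `|G| <= logn p (`|m| ^ 2))%N].
Proof.
move=> p_pr p4 G0 E1 E2 pG; have curve := mseq_curve seqABC n.
have coAB := mseq_coprime seqABC n.
have h1 : (p %| A n * (A n ^+ 3 + 8 * k * B n ^+ 6))%Z by rewrite -E1 dvdz_mulr.
have h2 : (p %| 4 * B n ^+ 2 * C n ^+ 2)%Z by rewrite -E2 dvdz_mulr.
have np4 : ~~ (p %| 4%R)%Z by apply: (@big_ndvdz p 4).
have np9 : ~~ (p %| 9%R)%Z.
  by rewrite (_ : 9 = 3%:Z ^+ 2) // prime_dvdzX // andbT; apply: big_ndvdz.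
have pA : (p %| A n)%Z.
  apply/negPn/negP => pA; move: h1; rewrite prime_dvdzM // (negPf pA) /= => h1.
  have pB : ~~ (p %| B n)%Z.
    apply: contra pA => pB; move: h1; rewrite prime_dvdzXD //.
    by rewrite exprS mulrCA dvdz_mulr.
  move: h2; rewrite !prime_dvdzMX // (negPf np4) (negPf pB) /= => pC.
  have : (p %| A n ^+ 3 + 8 * k * B n ^+ 6 - C n ^+ 2)%Z.
    by rewrite rpredB // prime_dvdzX // pC.
  have -> : A n ^+ 3 + 8 * k * B n ^+ 6 - C n ^+ 2 = 9 * (k * B n ^+ 6).
    by rewrite curve; ring.
  rewrite prime_dvdzM // (negPf np9) prime_dvdzMX // (negPf pB) /= orbF => pk.
  by move/negP: pA; apply; move: h1; rewrite prime_dvdzXD // -mulrA mulrCA dvdz_mulr.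
have pB := coprimez_ndvd p_pr coAB pA.
move: (h2); rewrite !prime_dvdzMX // (negPf np4) (negPf pB) /= => pC.
have pk : (p %| k)%Z.
  have : (p %| A n ^+ 3 - C n ^+ 2)%Z by rewrite rpredB // prime_dvdzX // ?pA ?pC.
  by rewrite curve addrC addKr prime_dvdzMX // (negPf pB) orbF.
have pm : (p %| m)%Z by rewrite -prime_big_dvd_k.
split => //; rewrite leqNgt; apply/negP => hlt.
have m20 : (0 < `|m| ^ 2)%N by rewrite expn_gt0 absz_gt0 m_neq0.
set e := (logn p (`|m| ^ 2)).+1 in hlt.
have pe : (p%:Z ^+ e %| G)%Z.
  by rewrite dvdzE abszX absz_nat pfactor_dvdn // absz_gt0 gt_eqF.
have hC : padic p e ((C n ^+ 2)%:~R).
  have u4 : padic_unit p ((4 * B n ^+ 2)%:~R).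
    by apply: (punit_int p_pr); rewrite prime_dvdzMX // negb_or np4.
  apply: (padic_divu p_pr u4); rewrite -rmorphM mulrC -E2.
  by apply: padic_dvd => //; apply: dvdz_mulr.
have r1 := numer_cube_near seqABC p_pr p4 m_neq0 kE (m_cube_free p_pr) pA.
have k0 : k%:~R != 0 :> rat by rewrite gt_eqF // ltr0z (mseq_k_gt0 seqABC).
have ur : padic_unit p ((A n)%:~R ^+ 3 / k%:~R - (B n)%:~R ^+ 6).
  rewrite addrC; apply: punitD => //; rewrite -mulN1r; apply: punitM => //.
    by exists (-1), 1; rewrite rpredN ndvdz1 //=; split => //; rewrite divr1.
  by apply: punitX => //; apply: punit_int.
have hk : padic p e k%:~R.
  apply: (padic_divu p_pr ur).
  have -> // : k%:~R * ((A n)%:~R ^+ 3 / k%:~R - (B n)%:~R ^+ 6) = (C n ^+ 2)%:~R :> rat.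
  have -> : C n ^+ 2 = A n ^+ 3 - k * B n ^+ 6 by rewrite curve addrK.
  by field.
have hm : padic p e ((m ^+ 2)%:~R).
  apply: (padic_divu p_pr (punit432 p_pr p4)); rewrite mulrC.
  have -> // : 432 * (m ^+ 2)%:~R = k%:~R :> rat by rewrite kE; ring.
move: hm => /(dvd_padic p_pr); rewrite dvdzE !abszX absz_nat pfactor_dvdn //.
by rewrite ltnn.
Qed.

(** The part d of A_n at 2 and 3 enters A_n^4 as d^4, and the same part of the duplication numerator
    divides 9 d^4; so d cancels and only the 9 remains. *)
Lemma part6_doubling n : exists g, [/\ (part6 (A n) ^ 4 <= 9 * (g * part6 (A (n + n))))%N,
  (g %| part6 m ^ 2)%N &
  (forall p, prime p -> (4 < p)%N -> (p %| A n)%Z -> ~~ (p %| m)%Z) -> g = 1%N].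
Proof.
have [G [G0 E1 E2]] := doubling seqABC n.
have hG p := @gcd_doubling_prime n G p.
exists (part6 G).
have aG : (0 < `|G|)%N by rewrite absz_gt0 gt_eqF.
split; last first.
- move=> h; apply: part_p'nat; apply/pnatP => // p p_pr pG; rewrite !inE.
  apply/negP => p4; have [pA pm _] := hG p p_pr p4 G0 E1 E2 pG.
  by move: (h p p_pr p4 pA); rewrite pm.
- have m20 : (0 < part6 m ^ 2)%N by rewrite expn_gt0 part_gt0.
  apply: part_dvd_logn => // p p_pr p4 pG.
  have [_ _] := hG p p_pr p4 G0 E1 E2 pG.
  by rewrite !lognX logn_partn.
set N := _ * (_ + _) in E1.
have N0 : (0 < `|N|)%N by rewrite -E1 abszM muln_gt0 aG absA_gt0.
have a4 : (`|A n| ^ 4 <= `|N|)%N.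
  rewrite -lez_nat -abszX !gez0_abs ?exprn_ge0 ?(ltW (A_gt0 _)) //; last first.
    by rewrite -E1 mulr_ge0 // ltW.
  rewrite /N mulrDr -exprS lerDl; apply: mulr_ge0; first exact: ltW.
  rewrite -mulrA; apply: mulr_ge0 => //; apply: mulr_ge0; first exact: ltW (mseq_k_gt0 seqABC).
  by rewrite exprn_even_ge0.
have [d [dE d36 _]] := cofactor6 n.
have d0 : (0 < d)%N by case: (d) d36.
have NS : (part6 N = part6 G * part6 (A (n + n)))%N.
  by rewrite /part6 -E1 abszM partnM // absA_gt0.
have dlog p : prime p -> p \in big_primes^' -> logn p d = logn p `|A n|.
  move=> p_pr pp; rewrite dE lognM // ?part_gt0 //.
  rewrite (_ : logn p (part6 (A n)) = 0%N) ?addn0 //.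
  rewrite logn_coprime // prime_coprime //; apply/negP => pd.
  move/negP: pp; apply.
  by apply: (pnatPpi (part_pnat big_primes `|A n|)); rewrite mem_primes p_pr pd part_gt0.
have hN : (`|N|%N`_big_primes^' %| 9 * d ^ 4)%N.
  have d40 : (0 < 9 * d ^ 4)%N by rewrite muln_gt0 expn_gt0 d0.
  apply: part_dvd_logn => // p p_pr pp _.
  rewrite lognM ?expn_gt0 ?d0 // lognX dlog //.
  have m8 := m_cube_free (isT : prime 2); have m27 := m_cube_free (isT : prime 3).
  rewrite /N kE; case: (big_primesP p_pr pp) => ->.
    have [_ h] := logn2_numer (mseq_coprime seqABC n) (curve432 n) m8.
    by rewrite (_ : logn 2 9 = 0%N).
  have [_ _ h] := logn3_numer (mseq_coprime seqABC n) (curve432 n) m27.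
  by rewrite (_ : logn 3 9 = 2%N) // addnC.
have d40 : (0 < d ^ 4)%N by rewrite expn_gt0 d0.
rewrite -(leq_pmul2l d40) -expnMn -dE (leq_trans a4) //.
rewrite -NS -{1}(partnC big_primes N0) mulnC mulnA (mulnC (d ^ 4)%N) leq_mul2r.
by rewrite (dvdn_leq _ hN) ?orbT // muln_gt0 expn_gt0 d0.
Qed.

(** Each prime p has its own q; taking the product over all admissible q removes the dependence on
    p. *)
Lemma part6_zsigmondy n : (0 < n)%N ->
  (forall p, prime p -> (p %| A n)%Z -> exists2 i, (0 < i < n)%N & (p %| A i)%Z) ->
  (part6 (A n) %| n * \prod_(q <- primes n | q != 3) part6 (A (n %/ q)%N))%N.
Proof.
move=> n0 h; have P0 : (0 < \prod_(q <- primes n | q != 3) part6 (A (n %/ q)%N))%N.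
  by apply: prodn_gt0 => q; apply: part_gt0.
apply: part_dvd_logn; first by rewrite muln_gt0 n0.
move=> p p_pr p4 pA; have [i hi pi] := h p p_pr pA.
have [q [q_pr q3 qn le]] := logn_numer_le seqABC p_pr p4 m_neq0 kE (m_cube_free p_pr) hi pA pi.
apply: (leq_trans le); rewrite lognM // addnC leq_add2l.
have qmem : q \in primes n by rewrite mem_primes q_pr n0 qn.
rewrite -(logn_partn _ (p4 : p \in big_primes)).
apply: dvdn_leq_log => //; rewrite (big_rem q) //= q3 dvdn_mulr //.
Qed.

End CubeFreeSeq.

(** * Canonical height *)

Section CanonicalHeight.
Variables (R : realType) (f : nat -> R) (L : R).
Hypotheses (L_ge0 : 0 <= L) (f_ge0 : forall n, (0 < n)%N -> 0 <= f n).
Hypothesis f_double : forall n, (0 < n)%N -> f (n + n)%N <= 4 * f n + L.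
Hypothesis f_parallelogram : forall i j, (0 < j < i)%N ->
  f (i + j)%N + f (i - j)%N <= 2 * f i + 2 * f j + L.

(* Adding L / 2 makes a decreasing in k and turns the parallelogram inequality
   into one without error term at every level k. *)
Let a (n k : nat) : R := (f (2 ^ k * n)%N + L / 2) / 4 ^+ k.
Let H (n : nat) : R := inf (range (a n)).

Let pow4_gt0 k : 0 < 4 ^+ k :> R. Proof. by rewrite exprn_gt0. Qed.
Let pow2n_gt0 k n : (0 < n)%N -> (0 < 2 ^ k * n)%N.
Proof. by move=> n0; rewrite muln_gt0 expn_gt0. Qed.

Let a_ge0 n k : (0 < n)%N -> 0 <= a n k.
Proof.
move=> n0; apply: divr_ge0; last exact: ltW.
by apply: addr_ge0; [apply: f_ge0; apply: pow2n_gt0 | apply: divr_ge0].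
Qed.

Let H_le n k : (0 < n)%N -> H n <= a n k.
Proof.
move=> n0; apply: ge_inf; last by exists k.
by exists 0 => _ [l _ <-]; apply: a_ge0.
Qed.

Let le_H n c : (0 < n)%N -> (forall k, c <= a n k) -> c <= H n.
Proof. by move=> n0 h; apply: lb_le_inf => [|_ [k _ <-]]; [exists (a n 0%N), 0%N | exact: h]. Qed.

Let a_succ n k : a n k.+1 = a (n + n) k / 4.
Proof.
rewrite /a exprSr invfM mulrA; congr ((f _ + _) / _ / _).
by rewrite addnn -mul2n mulnA expnSr.
Qed.

Let a_decr n k : (0 < n)%N -> a n k.+1 <= a n k.
Proof.
move=> n0; rewrite a_succ /a mulrAC ler_pM2r ?invr_gt0 // mulnDr.
have := f_double (pow2n_gt0 k n0); have := L_ge0. lra.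
Qed.

Let a_mono n k l : (0 < n)%N -> (k <= l)%N -> a n l <= a n k.
Proof.
move=> n0 /subnK <-; elim: (l - k)%N => [//|d IH].
by rewrite addSn; apply: le_trans IH; apply: a_decr.
Qed.

Let a_parallelogram i j k : (0 < j < i)%N ->
  a (i + j) k + a (i - j) k <= 2 * a i k + 2 * a j k.
Proof.
move=> /andP[j0 ji]; have h : (0 < 2 ^ k * j < 2 ^ k * i)%N.
  by rewrite pow2n_gt0 // ltn_pmul2l // expn_gt0.
have := f_parallelogram h; rewrite -mulnDr -mulnBr /a => hf.
rewrite !mulrA -!mulrDl ler_pM2r ?invr_gt0 //; lra.
Qed.

Let H_parallelogram_le i j : (0 < j < i)%N ->
  H (i + j) + H (i - j) <= 2 * H i + 2 * H j.
Proof.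
move=> hij; have /andP[j0 ji] := hij; have i0 : (0 < i)%N by apply: leq_trans ji.
have hp : (0 < i + j)%N by rewrite addn_gt0 i0.
have hm : (0 < i - j)%N by rewrite subn_gt0.
set x := _ + _.
(* Independent levels k and l allow the two infima on the right to be taken one after the other. *)
have key k l : x <= 2 * a i k + 2 * a j l.
  have h := a_parallelogram (maxn k l) hij.
  have h1 := H_le (maxn k l) hp; have h2 := H_le (maxn k l) hm.
  have h3 := a_mono i0 (leq_maxl k l); have h4 := a_mono j0 (leq_maxr k l).
  by rewrite /x; lra.
have hi l : (x - 2 * a j l) / 2 <= H i.
  by apply: le_H => // k; have := key k l; lra.
have : (x - 2 * H i) / 2 <= H j.
  by apply: le_H => // l; have := hi l; lra.
lra.
Qed.

Let H_double n : (0 < n)%N -> H (n + n) = 4 * H n.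
Proof.
move=> n0; have nn0 : (0 < n + n)%N by rewrite addn_gt0 n0.
apply/eqP; rewrite eq_le; apply/andP; split; last first.
  by apply: le_H => // k; have := H_le k.+1 n0; rewrite a_succ; lra.
suff : H (n + n) / 4 <= H n by lra.
apply: le_H => // k; apply: le_trans (a_decr k n0); rewrite a_succ.
by have := H_le k nn0; lra.
Qed.

(** The reverse inequality is the same one at the pair (n+1, n-1), whose left side is 4 H_n + 4
    H_1. *)
Let H_parallelogram n : (1 < n)%N -> H n.+1 + H n.-1 = 2 * H n + 2 * H 1%N.
Proof.
move=> n1; have h1 : (0 < 1 < n)%N by [].
have h2 : (0 < n.-1 < n.+1)%N by case: (n) n1 => [|[|]] // l _ /=; rewrite ltnS leqnSn.
have := H_parallelogram_le h1; have := H_parallelogram_le h2.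
rewrite addn1 subn1 (_ : n.+1 + n.-1 = n + n)%N; last by case: (n) n1 => // l _; rewrite addSnnS.
rewrite (_ : n.+1 - n.-1 = 1 + 1)%N; last by case: (n) n1 => // l _; rewrite /= -addn2 addKn.
rewrite !H_double // ?(ltnW n1) //; lra.
Qed.

Let H_quadratic n : (0 < n)%N -> H n = n%:R ^+ 2 * H 1%N.
Proof.
elim/ltn_ind: n => -[|[|[|n]]] // IH _; first by rewrite expr1n mul1r.
  by rewrite (H_double (n := 1)) //; ring.
have := H_parallelogram (n := n.+2) isT; rewrite /= (IH n.+2) // (IH n.+1) // => E.
have {}E : H n.+3 = 2 * (n.+2%:R ^+ 2 * H 1%N) + 2 * H 1%N - n.+1%:R ^+ 2 * H 1%N.
  by rewrite -E addrK.
by rewrite E; ring.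
Qed.

Lemma canonical_height : exists h : R, forall n, (0 < n)%N ->
  n%:R ^+ 2 * h <= f n + L / 2 /\
  (forall c, (forall k, 4 ^+ k * c <= f (2 ^ k * n)%N) -> c <= n%:R ^+ 2 * h).
Proof.
exists (H 1%N) => n n0; rewrite -H_quadratic //; split.
  by have := H_le 0 n0; rewrite /a expr0 divr1 expn0 mul1n.
move=> c hc; apply: le_H => // k; rewrite /a ler_pdivlMr // mulrC.
by apply: le_trans (hc k) _; rewrite lerDl divr_ge0.
Qed.

End CanonicalHeight.

(** * Sums over prime divisors and elementary inequalities *)

Lemma sum_sqr_div_le (n : nat) N :
  (\sum_(5 <= k < N.+4.+1) ((n %/ k) ^ 2))%N%:R <= n%:R ^+ 2 * (4^-1 - N.+4%:R^-1) :> rat.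
Proof.
elim: N => [|N IH]; first by rewrite big_geq // subrr mulr0.
rewrite big_nat_recr //= natrD natrX.
have h : (n %/ N.+1.+4)%:R <= n%:R / N.+1.+4%:R :> rat.
  by rewrite ler_pdivlMr ?ltr0n // -natrM ler_nat leq_trunc_div.
(* Telescoping by 1/k^2 <= 1/(k-1) - 1/k; the sum starts at 5 because a prime other than 2 and 3 is
   at least 5. *)
have h2 : (n %/ N.+1.+4)%:R ^+ 2 <= n%:R ^+ 2 * (N.+4%:R^-1 - N.+1.+4%:R^-1) :> rat.
  apply: (@le_trans _ _ ((n%:R / N.+1.+4%:R) ^+ 2)).
    by rewrite lerXn2r ?nnegrE ?divr_ge0.
  rewrite expr_div_n ler_wpM2l ?sqr_ge0 // -[N.+1.+4%:R]natr1.
  have x0 : 0 < N.+4%:R :> rat by rewrite ltr0n.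
  move: (N.+4%:R : rat) x0 => x x0.
  have -> : x^-1 - (x + 1)^-1 = (x * (x + 1))^-1.
    by field; rewrite !gt_eqF // addr_gt0.
  rewrite lef_pV2 ?posrE ?mulr_gt0 ?exprn_gt0 ?addr_gt0 // expr2 ler_pM2r ?addr_gt0 //.
  by rewrite lerDl.
have := lerD IH h2; rewrite -mulrDr => /le_trans; apply.
by rewrite addrA subrK.
Qed.

Lemma primes_sum_le n (F : nat -> nat) :
  (\sum_(q <- primes n | q != 3) F q <= F 2 + \sum_(5 <= k < n.+1) F k)%N.
Proof.
have -> : (F 2 + \sum_(5 <= k < n.+1) F k = \sum_(k <- 2 :: index_iota 5 n.+1) F k)%N.
  by rewrite big_cons.
rewrite -big_filter; apply: (uniq_sub_le_big (le := leq) leqnn (fun x y => leq_addr y x) predT F).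
- by rewrite filter_uniq // primes_uniq.
- by rewrite /= mem_index_iota iota_uniq.
move=> q; rewrite mem_filter mem_primes => /and4P[q3 q_pr n0 qn].
rewrite inE mem_index_iota ltnS (dvdn_leq n0 qn) andbT.
by case: q q3 q_pr {qn} => [|[|[|[|[|]]]]].
Qed.

(** The coefficient of h in the bound for the sum of the ln S_(n/q), with 29 h absorbing the error
    of each term. *)
Definition zsig_sum n := (\sum_(q <- primes n | q != 3) ((n %/ q) ^ 2 + 29))%N.

(** Thirteen times the coefficients of h in the final inequality: 50 comes from ln 3 + ln 36 and 27
    n / 13 from ln n. *)
Lemma zsig_sum_small n : (13 <= n < 64)%N ->
  (650 + 27 * n + 13 * zsig_sum n < 13 * n ^ 2)%N.
Proof.
have -> : zsig_sum n = sumn [seq ((n %/ q) ^ 2 + 29)%N | q <- primes n & q != 3%N].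
  by rewrite sumnE big_map big_filter.
have : all (fun n => 650 + 27 * n + 13 * sumn [seq ((n %/ q) ^ 2 + 29) | q <- primes n & q != 3]
    < 13 * n ^ 2)%N (iota 13 51) by vm_compute.
by move/allP => h n_range; apply: h; rewrite mem_iota.
Qed.

(** The telescoped sum gives at most n^2 / 2 + 28 n - 87, and from 64 on the other half of n^2
    absorbs the linear terms. *)
Lemma zsig_sum_large n : (64 <= n)%N ->
  (650 + 27 * n + 13 * zsig_sum n < 13 * n ^ 2)%N.
Proof.
move=> n64; have := primes_sum_le n (fun q => (n %/ q) ^ 2 + 29)%N.
rewrite -/(zsig_sum n) big_split /= sum_nat_const_nat.
have [N nE] : exists N, n = N.+4 by exists (n - 4)%N; lia.
have := sum_sqr_div_le n N; rewrite -nE.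
set T := (\sum_(5 <= k < _) _)%N => hT hZ.
have n0 : 0 < n%:R :> rat by rewrite ltr0n; apply: leq_trans n64.
have {}hT : T%:R <= n%:R ^+ 2 / 4 - n%:R :> rat.
  by apply: le_trans hT _; rewrite le_eqVlt; apply/orP; left; apply/eqP; field; rewrite gt_eqF.
have h4 : (4 * T + 4 * n <= n ^ 2)%N.
  rewrite -(ler_nat rat) natrD (natrM _ 4 T) (natrM _ 4 n) natrX; lra.
have h2 : (4 * (n %/ 2) ^ 2 <= n ^ 2)%N.
  by rewrite (_ : 4 = 2 ^ 2)%N // -expnMn leq_exp2r // mulnC leq_trunc_div.
have hn : (64 * n <= n ^ 2)%N by rewrite expnS expn1 leq_mul2r n64 orbT.
by move: hZ h4 h2 hn n64; clear; move: (zsig_sum n) ((n %/ 2) ^ 2)%N (n ^ 2)%N; lia.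
Qed.

Lemma zsig_sum_lt n : (13 <= n)%N -> (650 + 27 * n + 13 * zsig_sum n < 13 * n ^ 2)%N.
Proof.
move=> n13; case: (ltnP n 64) => h; last exact: zsig_sum_large.
by apply: zsig_sum_small; rewrite n13.
Qed.

(** Since (5/4)^6 < 4, twelve of the factors cost at most 4 and the last one at most 2, and 8 <=
    13. *)
Lemma expn13_succ x : (13 <= x)%N -> (x.+1 ^ 13 <= 13 * x ^ 13)%N.
Proof.
move=> x13; have h2 : (4 * x.+1 ^ 2 <= 5 * x ^ 2)%N.
  have : (13 * x <= x ^ 2)%N by rewrite expnS expn1 leq_mul2r x13 orbT.
  by rewrite -[x.+1]addn1 sqrnD exp1n muln1; move: (x ^ 2)%N x13; clear; lia.
have : ((4 * x.+1 ^ 2) ^ 6 <= (5 * x ^ 2) ^ 6)%N by rewrite leq_exp2r.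
rewrite expnMn [((5 * _) ^ 6)%N]expnMn -2!expnM => h12.
have {}h12 : (x.+1 ^ 12 <= 4 * x ^ 12)%N.
  have h0 : (0 < 4 ^ 6)%N by [].
  rewrite -(leq_pmul2l h0); apply: (leq_trans h12).
  by rewrite mulnA leq_mul2r; apply/orP; right; vm_compute.
rewrite 2![(_ ^ 13)%N]expnS mulnA; apply: (@leq_trans (2 * x * (4 * x ^ 12))).
  by apply: leq_mul => //; rewrite mul2n -addnn -addn1 leq_add2l; apply: leq_trans x13.
by rewrite mulnA leq_mul2r mulnAC leq_mul2r orbT orbT.
Qed.

Lemma expn13_le n : (13 <= n)%N -> (n ^ 13 <= 13 ^ n)%N.
Proof.
move=> /subnK <-; elim: (n - 13)%N => [|d IH]; first exact: leqnn.
rewrite addSn [(13 ^ _.+1)%N]expnS; apply: leq_trans (leq_mul (leqnn 13) IH).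
by apply: expn13_succ; rewrite leq_addl.
Qed.

(** In logarithms, 6 ln 108 <= 11 (ln 125 - ln 9), so ln 125 - ln 9 <= 27 h yields ln 3 + ln 36 <=
    50 h. *)
Lemma ineq_108_9_125 (F : realFieldType) : 108%:R ^+ 6 * 9%:R ^+ 11 <= 125%:R ^+ 11 :> F.
Proof. lra. Qed.

(** * Logarithmic estimates *)

Section LogHeight.
Variable R : realType.
Definition lnn (n : nat) : R := ln n%:R.

Lemma lnnM a b : (0 < a)%N -> (0 < b)%N -> lnn (a * b) = lnn a + lnn b.
Proof. by move=> a0 b0; rewrite /lnn natrM lnM // posrE ltr0n. Qed.

Lemma lnnX a e : (0 < a)%N -> lnn (a ^ e) = e%:R * lnn a.
Proof. by move=> a0; rewrite /lnn natrX lnXn ?ltr0n // mulr_natl. Qed.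

Lemma lnn_le a b : (0 < a)%N -> (a <= b)%N -> lnn a <= lnn b.
Proof.
move=> a0 ab; rewrite /lnn ler_ln ?posrE ?ltr0n ?ler_nat //.
exact: leq_trans ab.
Qed.

Lemma lnn_ge0 a : 0 <= lnn a.
Proof.
by case: a => [|a]; [rewrite /lnn ln0 | rewrite /lnn ln_ge0 // ler1n].
Qed.

Lemma lnn_pow_le a b c e f g : (0 < a)%N -> (0 < b)%N -> (0 < c)%N ->
  a%:R ^+ e * b%:R ^+ f <= c%:R ^+ g :> R ->
  e%:R * lnn a + f%:R * lnn b <= g%:R * lnn c.
Proof.
move=> a0 b0 c0; rewrite /lnn -ler_ln ?posrE ?mulr_gt0 ?exprn_gt0 ?ltr0n //.
rewrite lnM ?posrE ?exprn_gt0 ?ltr0n //.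
by rewrite !lnXn ?ltr0n // !mulr_natl.
Qed.

Variables (k m : int) (A B C : nat -> int).
Hypothesis seqABC : mordell_seq k A B C.
Hypotheses (m_neq0 : m != 0) (kE : k = 432 * m ^+ 2).
Hypothesis m_cube_free : forall p, prime p -> ~~ (p%:Z ^+ 3 %| m)%Z.

Let a0 n : (0 < `|A n|)%N := absA_gt0 seqABC n.
Local Notation S n := (part6 (A n)).
Let S0 n : (0 < S n)%N. Proof. exact: part_gt0. Qed.

Lemma numer_parallelogram_nat i j : (j <= i)%N ->
  (`|A (i + j)%N| * `|A (i - j)%N| <= 9 * (`|A i| ^ 2 * `|A j| ^ 2))%N.
Proof.
move=> ij; have := numer_parallelogram seqABC ij.
have p0 n : 0 <= A n by apply: ltW (mseq_A_gt0 seqABC n).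
by rewrite -!abszX -!abszM -lez_nat PoszM !gez0_abs // mulr_ge0 // exprn_ge0.
Qed.

Lemma numer_height : exists h : R, forall n, (0 < n)%N ->
  n%:R ^+ 2 * h <= lnn `|A n| + lnn 3 /\
  (forall g, (0 < g)%N -> (forall l, exists g', [/\ (0 < g')%N, (g' <= g)%N &
      (S (2 ^ l * n) ^ 4 <= 9 * (g' * S (2 ^ l * n + 2 ^ l * n)))%N]) ->
    lnn (S n) - (lnn 9 + lnn g) / 3 <= n%:R ^+ 2 * h).
Proof.
have fM i j : (j <= i)%N ->
    lnn `|A (i + j)%N| + lnn `|A (i - j)%N| <= 2 * lnn `|A i| + 2 * lnn `|A j| + lnn 9.
  move=> ij; have := numer_parallelogram_nat ij.
  have p0 : (0 < `|A (i + j)%N| * `|A (i - j)%N|)%N by rewrite muln_gt0 !a0.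
  move/(lnn_le p0); rewrite lnnM // lnnM ?muln_gt0 ?expn_gt0 ?a0 // lnnM ?expn_gt0 ?a0 //.
  by rewrite !lnnX //; lra.
have fD n : (0 < n)%N -> lnn `|A (n + n)%N| <= 4 * lnn `|A n| + lnn 9.
  move=> _; have := fM n n (leqnn n); rewrite subnn (mseq_A0 seqABC) absz1.
  by rewrite /lnn ln1; lra.
have f0 n : (0 < n)%N -> 0 <= lnn `|A n| by move=> _; apply: lnn_ge0.
have fP i j : (0 < j < i)%N ->
    lnn `|A (i + j)%N| + lnn `|A (i - j)%N| <= 2 * lnn `|A i| + 2 * lnn `|A j| + lnn 9.
  by case/andP => _ /ltnW; apply: fM.
have [h hh] := canonical_height (lnn_ge0 9) f0 fD fP.
have l9 : lnn 9 = 2 * lnn 3 by rewrite -(lnnX 2 (isT : (0 < 3)%N)).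
exists h => n n0; have [h1 h2] := hh n n0; split; first by move: h1; rewrite l9; lra.
move=> g g0 hg; apply: h2 => l.
(* The fixed point of x -> 4 x - (ln 9 + ln g): the excess of ln S over t at least quadruples with
   each doubling. *)
set t := (lnn 9 + lnn g) / 3.
have t0 : 0 <= t by rewrite divr_ge0 // addr_ge0 // lnn_ge0.
suff h2 : 4 ^+ l * (lnn (S n) - t) + t <= lnn (S (2 ^ l * n)).
  have le : lnn (S (2 ^ l * n)) <= lnn `|A (2 ^ l * n)%N|.
    by apply: lnn_le => //; rewrite dvdn_leq // dvdn_part.
  by apply: le_trans le; apply: le_trans h2; rewrite lerDl.
elim: l => [|l IH]; first by rewrite expr0 mul1r expn0 mul1n subrK.
have [g' [g'0 g'g]] := hg l.
have p0 : (0 < S (2 ^ l * n) ^ 4)%N by rewrite expn_gt0 S0.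
move/(lnn_le p0); rewrite lnnX // lnnM // ?muln_gt0 ?g'0 ?S0 // lnnM //.
have := lnn_le g'0 g'g.
rewrite (_ : 2 ^ l.+1 * n = 2 ^ l * n + 2 ^ l * n)%N; last by rewrite expnS -mulnA mul2n addnn.
rewrite exprS; move: IH; rewrite /t; move: (4 ^+ l : R) => y.
lra.
Qed.

Lemma zsigmondy_upper n : (0 < n)%N ->
  (forall p, prime p -> (p %| A n)%Z -> exists2 i, (0 < i < n)%N & (p %| A i)%Z) ->
  lnn (S n) <= lnn n + \sum_(q <- primes n | q != 3%N) lnn (S (n %/ q)).
Proof.
move=> n0 h; have := part6_zsigmondy seqABC m_neq0 kE m_cube_free n0 h.
have P0 : (0 < \prod_(q <- primes n | q != 3) S (n %/ q)%N)%N.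
  by apply: prodn_gt0 => q; apply: part_gt0.
move/dvdn_leq; rewrite muln_gt0 n0 P0 => /(_ isT) /(lnn_le (S0 n)).
rewrite lnnM // => /le_trans; apply; rewrite lerD2l.
elim: (primes n) => [|q s IH]; first by rewrite !big_nil /lnn ln1.
rewrite !big_cons; case: ifP => // _.
rewrite lnnM ?lerD2l ?S0 //.
by apply: prodn_gt0 => j; apply: part_gt0.
Qed.

Lemma zsigmondy_contradiction (h E : R) n : (13 <= n)%N ->
  lnn 125 - lnn 9 <= 27 * h -> E <= 29 * h ->
  (forall i, (0 < i)%N -> lnn (S i) <= i%:R ^+ 2 * h + E) ->
  n%:R ^+ 2 * h <= lnn `|A n| + lnn 3 ->
  lnn (S n) <= lnn n + \sum_(q <- primes n | q != 3%N) lnn (S (n %/ q)) -> False.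
Proof.
move=> n13 hb hE hS hn hz; have n0 : (0 < n)%N by apply: leq_trans n13.
have h0 : 0 < h.
  have : lnn 9 < lnn 125 by rewrite /lnn ltr_ln ?posrE ?ltr0n ?ltr_nat.
  lra.
have e108 : lnn 3 + lnn 36 <= 50 * h.
  have := @lnn_pow_le 108 9 125 6 11 11 isT isT isT.
  have -> : lnn 108 = lnn 3 + lnn 36 by rewrite -lnnM.
  move/(_ (ineq_108_9_125 R)); lra.
(* ln n / n <= ln 13 / 13 from 13 on, and 9 * 13 = 117 <= 125. *)
have ln_n : 13 * lnn n <= 27 * n%:R * h.
  have h13 : lnn 13 <= 27 * h.
    apply: le_trans hb; rewrite lerBrDr -lnnM //; exact: lnn_le.
  have := lnn_le (_ : 0 < n ^ 13)%N (expn13_le n13); rewrite expn_gt0 n0 => /(_ isT).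
  rewrite !lnnX // => /le_trans; apply; rewrite mulrAC [leRHS]mulrC.
  by rewrite ler_wpM2l // ler0n.
have hA : lnn `|A n| <= lnn 36 + lnn (S n).
  rewrite -lnnM //; apply: lnn_le => //.
  exact: absA_le_part6 seqABC kE m_cube_free n.
have hsum : \sum_(q <- primes n | q != 3%N) lnn (S (n %/ q)) <= (zsig_sum n)%:R * h.
  rewrite /zsig_sum natr_sum mulr_suml big_seq_cond [leRHS]big_seq_cond.
  apply: ler_sum => q /andP[]; rewrite mem_primes => /and3P[q_pr _ qn] _.
  have q0 : (0 < n %/ q)%N by rewrite divn_gt0 ?prime_gt0 // dvdn_leq.
  apply: le_trans (hS _ q0) _; rewrite natrD natrX mulrDl lerD2l //.
have := zsig_sum_lt n13.
rewrite -(ltr_nat R) 2!natrD (natrM _ 27) (natrM _ 13 (zsig_sum n)) (natrM _ 13 (n ^ 2)).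
rewrite natrX -(ltr_pM2r h0); lra.
Qed.

Lemma part6_ge5 x : x != 0 -> part6 x != 1%N -> (5 <= part6 x)%N.
Proof.
move=> x0 S1; have p0 : (0 < part6 x)%N by apply: part_gt0.
have p1 : (1 < part6 x)%N by rewrite ltn_neqAle eq_sym S1.
have : pdiv (part6 x) \in big_primes.
  by apply: (pnatPpi (part_pnat _ `|x|)); rewrite mem_primes pdiv_prime // p0 pdiv_dvd.
by rewrite !inE => /leq_trans; apply; apply: dvdn_leq (pdiv_dvd _).
Qed.

Lemma ineq_18_9_125 (F : realFieldType) : 18%:R ^+ 9 * 9%:R ^+ 10 <= 125%:R ^+ 10 :> F.
Proof. lra. Qed.

(** Here g is exchanged for S_3, which leaves 9 h + (2/3) ln 18, as 4 * 9^2 = 18^2. Now 9 ln 18 <=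
    10 (ln 125 - ln 9) <= 270 h, hence 29 = 9 + 20. *)
Lemma singular_bound (h : R) (g : nat) : (0 < g)%N -> (5 <= S 3)%N ->
  (g <= 4 * S 3 ^ 3)%N -> lnn (S 3) - lnn 9 / 3 <= 9 * h ->
  lnn 125 - lnn 9 <= 27 * h /\ (lnn 9 + lnn g) / 3 <= 29 * h.
Proof.
move=> g0 S5 gS hS; have h5 := lnn_le (isT : 0 < 5)%N S5.
have e125 : lnn 125 = 3 * lnn 5 by rewrite -(lnnX 3 (isT : (0 < 5)%N)).
have := lnn_le g0 gS; rewrite lnnM ?expn_gt0 ?S0 // lnnX // => hg.
have := @lnn_pow_le 18 9 125 9 10 10 isT isT isT (ineq_18_9_125 R).
have e18 : lnn 18 + lnn 18 = lnn 4 + lnn 9 + lnn 9 by rewrite -!lnnM.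
split; lra.
Qed.

Lemma nonsingular_bound (h : R) : 0 <= h -> lnn 5 - lnn 9 / 3 <= 4 * h ->
  lnn 125 - lnn 9 <= 27 * h /\ lnn 9 / 3 <= 29 * h.
Proof.
move=> h0 h5.
have e125 : lnn 125 = 3 * lnn 5 by rewrite -(lnnX 3 (isT : (0 < 5)%N)).
have l9 : lnn 9 <= 2 * lnn 5.
  by rewrite -(lnnX 2 (isT : (0 < 5)%N)); apply: lnn_le.
split; lra.
Qed.

End LogHeight.

(** * Lower bounds for the numerators of small multiples *)

Lemma divisors36 d : (d %| 36)%N -> (d <= 12)%N || (9 %| d)%N.
Proof.
move=> d36; have d37 : d \in iota 0 37 by rewrite mem_iota ltnS (dvdn_leq _ d36).
have /allP /(_ d d37) : all (fun d => (d %| 36) ==> ((d <= 12) || (9 %| d)))%N (iota 0 37) by [].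
by rewrite d36.
Qed.

Lemma divisors36_ge8 d : (d %| 36)%N -> (8 <= d)%N ->
  [|| d == 9, d == 12, d == 18 | d == 36]%N.
Proof.
move=> d36; have d37 : d \in iota 0 37 by rewrite mem_iota ltnS (dvdn_leq _ d36).
have /allP /(_ d d37) : all (fun d => (d %| 36) ==> (8 <= d) ==>
  [|| d == 9, d == 12, d == 18 | d == 36])%N (iota 0 37) by [].
by rewrite d36 /= => /implyP.
Qed.

Section Dichotomy.
Variables (k m : int) (A B C : nat -> int).
Hypothesis seqABC : mordell_seq k A B C.
Hypotheses (m_neq0 : m != 0) (kE : k = 432 * m ^+ 2).
Hypothesis m_cube_free : forall p, prime p -> ~~ (p%:Z ^+ 3 %| m)%Z.

Local Notation S n := (part6 (A n)).

Lemma numer_lower n : (0 < n)%N -> (432 * `|m| ^ 2 * (`|B n| ^ 2) ^ 3 <= `|A n| ^ 3)%N.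
Proof.
move=> n0; have := kB_leA seqABC n; have A0 := ltW (mseq_A_gt0 seqABC n).
have k0 := ltW (mseq_k_gt0 seqABC).
have -> : (432 * `|m| ^ 2 * (`|B n| ^ 2) ^ 3)%N = `|(k * (B n ^+ 2) ^+ 3)%R|%N.
  by rewrite kE [RHS]abszM abszX abszX abszM abszX.
rewrite -abszX -lez_nat !gez0_abs ?exprn_ge0 // mulr_ge0 // exprn_ge0 //.
exact: sqr_ge0.
Qed.

Lemma absB_gt0 n : (0 < n)%N -> (0 < `|B n| ^ 2)%N.
Proof. by move=> n0; rewrite expn_gt0 absz_gt0 (mseq_B_neq0 seqABC). Qed.

Lemma part6_le_abs : (part6 m <= `|m|)%N.
Proof. by rewrite dvdn_leq ?absz_gt0 // dvdn_part. Qed.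

Lemma part6_le_abs9 : (9 %| m)%Z -> (9 * part6 m <= `|m|)%N.
Proof.
move=> m9; rewrite dvdn_leq ?absz_gt0 // Gauss_dvd ?dvdn_part ?andbT //.
rewrite (_ : 9 = 3 ^ 2)%N // coprimeXl // prime_coprime //.
apply/negP => h3; have : 3%N \in big_primes; last by [].
by apply: (pnatPpi (part_pnat _ `|m|)); rewrite mem_primes part_gt0 h3.
Qed.

(** In 432 m^2 <= (d S_n)^3 the case d <= 12 gives 4 = 12^3 / 432. For d = 18 or 36 the factor 9 of
    m compensates: 36^3 / (432 * 81) < 4. *)
Lemma part6_numer_lower n : (0 < n)%N -> (part6 m ^ 2 <= 4 * S n ^ 3)%N.
Proof.
move=> n0; have := numer_lower n0.
have b0 := absB_gt0 n0; have [d [dE d36 d9]] := cofactor6 seqABC kE m_cube_free n.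
rewrite dE; set s := S n; set b := (`|B n| ^ 2)%N in b0 *.
have {}b0 : (0 < b ^ 3)%N by rewrite expn_gt0 b0.
move=> h; have {}h : (432 * `|m| ^ 2 <= (d * s) ^ 3)%N.
  by apply: leq_trans h; rewrite leq_pmulr.
case/orP: (divisors36 d36) => hd.
  have hm : (part6 m ^ 2 <= `|m| ^ 2)%N by rewrite leq_exp2r // part6_le_abs.
  have : (432 * part6 m ^ 2 <= 432 * (4 * s ^ 3))%N.
    apply: (@leq_trans (432 * `|m| ^ 2)); first by rewrite leq_mul2l.
    apply: leq_trans h _; rewrite expnMn mulnA leq_mul2r; apply/orP; right.
    by apply: (@leq_trans (12 ^ 3)); rewrite // leq_exp2r.
  by rewrite leq_pmul2l.
have hm : ((9 * part6 m) ^ 2 <= `|m| ^ 2)%N by rewrite leq_exp2r // part6_le_abs9 // d9.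
have : (432 * (9 * part6 m) ^ 2 <= 432 * (108 * s ^ 3))%N.
  apply: (@leq_trans (432 * `|m| ^ 2)); first by rewrite leq_mul2l.
  apply: leq_trans h _; rewrite expnMn mulnA leq_mul2r; apply/orP; right.
  apply: (@leq_trans (36 ^ 3)); first by rewrite leq_exp2r // dvdn_leq.
  by vm_compute.
rewrite leq_pmul2l // expnMn; move: (part6 m ^ 2)%N (s ^ 3)%N => x y; clear; lia.
Qed.

(* S_1 = 1 forces |m| = 1 or 2, where Q is torsion, or |m| = 9, where
   A_2 = 252 B_2^2. *)
Lemma numer1_large_or_2 : (5 <= S 1)%N \/ (5 <= S 2)%N.
Proof.
have Am_neq0 n : A n != 0 by rewrite gt_eqF // (mseq_A_gt0 seqABC).
have [S1|S1] := eqVneq (S 1) 1%N; last by left; apply: part6_ge5.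
have := numer_lower (isT : (0 < 1)%N).
have := absB_gt0 (isT : (0 < 1)%N).
have [d [dE d36 d9]] := cofactor6 seqABC kE m_cube_free 1.
have := absA seqABC 1; rewrite dE S1 muln1 => AE.
set b := (`|B 1%N| ^ 2)%N => b0 hlow.
have m0 : (0 < `|m|)%N by rewrite absz_gt0.
have curve := mseq_curve seqABC 1.
have b1 : (b ^ 3 < 8)%N -> B 1%N ^+ 2 = 1.
  move=> b8; have bE : b = 1%N.
    by apply/eqP; rewrite eqn_leq b0 andbT leqNgt; apply/negP => b2;
       move: b8; rewrite ltnNge (@leq_exp2r 2 b 3) ?b2.
  by apply/eqP; rewrite -[B 1%N ^+ 2]gez0_abs ?sqr_ge0 // abszX -/b bE.
clearbody b.
have x0 : (0 < `|m| ^ 2 * b ^ 3)%N by rewrite muln_gt0 !expn_gt0 m0 b0.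
rewrite -mulnA in hlow.
have m9 : (9 %| d)%N -> (81 <= `|m| ^ 2 * b ^ 3)%N.
  move=> /d9 h9; apply: (@leq_trans (9 ^ 2 * 1)) => //.
  by apply: leq_mul; [rewrite leq_exp2r // dvdn_leq | rewrite expn_gt0 b0].
(* 7^3 = 343 < 432. *)
have d8 : (8 <= d)%N.
  rewrite leqNgt ltnS; apply/negP => d7.
  have : (d ^ 3 <= 7 ^ 3)%N by rewrite leq_exp2r.
  move/(leq_trans hlow); rewrite leqNgt => /negP; apply.
  by apply: (@leq_trans (432 * 1)) => //; rewrite leq_mul2l x0 orbT.
case/or4P: (divisors36_ge8 d36 d8) => /eqP dE'; rewrite {}dE' in hlow m9 AE d9.
(* For d = 9, as for d = 18 below, 9 divides m, but d^3 < 432 * 81. *)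
- move: hlow; rewrite leqNgt => /negP; case.
  by apply: (@leq_trans (432 * 81)) => //; rewrite leq_mul2l m9 // orbT.
- have hx : (`|m| ^ 2 * b ^ 3 <= 4)%N by rewrite -(@leq_pmul2l 432).
  have B1 : B 1%N ^+ 2 = 1.
    apply: b1; apply: (@leq_ltn_trans 4) => //; apply: leq_trans hx.
    by rewrite leq_pmull // expn_gt0 m0.
  have m2 : (`|m| <= 2)%N.
    rewrite -(@leq_exp2r _ _ 2) //; apply: leq_trans hx.
    by rewrite leq_pmulr // expn_gt0 b0.
  have B6 : B 1%N ^+ 6 = 1 by rewrite (_ : 6 = 2 * 3)%N // exprM B1 expr1n.
  have [mE|mE] : m ^+ 2 = 1 \/ m ^+ 2 = 4.
  + have : (`|m| == 1)%N || (`|m| == 2)%N by move: m0 m2; clear; lia.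
    by rewrite -[m ^+ 2]gez0_abs ?sqr_ge0 // abszX => /orP[] /eqP ->; [left|right].
  (* The point has x = 12, and r = 4 is a zero of the triplication numerator, so 3Q would be
     infinity. *)
  + have rE : (A 1%N)%:~R ^+ 3 / k%:~R = 4%:R :> rat.
      by rewrite kE mE mulr1 rmorph_nat -AE -pmulrn; field.
    have Br : (B 1%N)%:~R ^+ 6 = 1 :> rat by rewrite -rmorphXn /= B6.
    have B12 : (B 1%N)%:~R ^+ 12 = 1 :> rat by rewrite (_ : 12 = 6 * 2)%N // exprM Br expr1n.
    have B18 : (B 1%N)%:~R ^+ 18 = 1 :> rat by rewrite (_ : 18 = 6 * 3)%N // exprM Br expr1n.
    have := tripling seqABC (isT : (0 < 1)%N); cbv zeta; rewrite rE.
    have td0 : tripling_den B 1 4%:R != 0 by rewrite /tripling_den B12 B18 Br; apply: lt0r_neq0; lra.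
    have u0 : abscissa_inv A B (3 * 1) != 0 by exact: (lt0r_neq0 (uval_gt0 seqABC (isT : (0 < 3 * 1)%N))).
    have k0 : k%:~R != 0 :> rat by exact: (lt0r_neq0 (kr_gt0 seqABC)).
    move=> T; have : k%:~R * abscissa_inv A B (3 * 1) * tripling_den B 1 4%:R == 0.
      by rewrite T Br; apply/eqP; ring.
    by rewrite mulf_eq0 mulf_eq0 (negPf k0) (negPf u0) (negPf td0).
  (* Again x = 12, but now y = 0 and 2Q would be infinity. *)
  + have C0 : C 1%N ^+ 2 = 0.
      by apply: (addIr (k * B 1%N ^+ 6)); rewrite -curve kE mE B6 -AE; ring.
    have [G [G0 _]] := doubling seqABC 1; rewrite C0 mulr0 => /eqP.
    by rewrite mulf_eq0 gt_eqF //= sqrf_eq0 (negPf (mseq_B_neq0 seqABC _)).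
- move: hlow; rewrite leqNgt => /negP; case.
  by apply: (@leq_trans (432 * 81)) => //; rewrite leq_mul2l m9 // orbT.
right; apply: part6_ge5 => //.
(* 36^3 = 432 * 108, and 9 divides m, so only x = 36 with m^2 = 81 survives; the 7 in A_2 then makes
   S_2 large. *)
have hx : (`|m| ^ 2 * b ^ 3 <= 108)%N by rewrite -(@leq_pmul2l 432).
have m9d := d9 isT.
have m9le : (9 <= `|m|)%N by rewrite dvdn_leq.
have m10 : (`|m| <= 10)%N.
  rewrite leqNgt; apply/negP => m11; move: hx; rewrite leqNgt => /negP; apply.
  by apply: (@leq_trans (11 ^ 2 * 1)) => //; apply: leq_mul; rewrite ?leq_exp2r // expn_gt0 b0.
have mE : m ^+ 2 = 81.
  have : (`|m| = 9)%N by move: m9le m10; case/dvdnP: m9d => q ->; clear; lia.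
  by rewrite -[m ^+ 2]gez0_abs ?sqr_ge0 // abszX => ->.
have B1 : B 1%N ^+ 2 = 1.
  apply: b1; rewrite ltnNge; apply/negP => b8; move: hx; rewrite leqNgt => /negP; apply.
  by apply: (@leq_trans (9 ^ 2 * 8)) => //; apply: leq_mul; rewrite ?leq_exp2r.
have B6 : B 1%N ^+ 6 = 1 by rewrite (_ : 6 = 2 * 3)%N // exprM B1 expr1n.
have CE : C 1%N ^+ 2 = 27 * 432.
  by apply: (addIr (k * B 1%N ^+ 6)); rewrite -curve kE mE B6 -AE; ring.
have [G [G0]] := doubling seqABC 1; rewrite CE B1 B6 kE mE -AE => E1 E2.
have A2 : A 2 = 7 * (36 * B 2 ^+ 2).
  apply: (mulfI (lt0r_neq0 G0)); rewrite E1 [RHS]mulrCA [G * _]mulrCA E2; ring.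
have h7 : (7 %| `|A 2|)%N by rewrite A2 abszM dvdn_mulr.
apply/negP; rewrite /part6 partn_eq1 ?(absA_gt0 seqABC) // => /pnatP.
by move/(_ (absA_gt0 seqABC 2) 7%N isT h7).
Qed.

End Dichotomy.

(** * Existence of a new prime *)

Section PrimitiveDivisor.
Variables (k m : int) (A B C : nat -> int).
Hypothesis seqABC : mordell_seq k A B C.
Hypotheses (m_neq0 : m != 0) (kE : k = 432 * m ^+ 2).
Hypothesis m_cube_free : forall p, prime p -> ~~ (p%:Z ^+ 3 %| m)%Z.

Local Notation S n := (part6 (A n)).

(* If some p >= 5 divides both m and A_1, then 3Q is nonsingular at all such
   primes and its height is compared with m; otherwise duplication loses
   nothing at p >= 5. *)
Lemma ex_new_prime (R : realType) n : (13 <= n)%N ->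
  exists2 p, prime p & (p %| A n)%Z /\ forall i, (0 < i < n)%N -> ~~ (p %| A i)%Z.
Proof.
move=> n13; apply: contrapT => hno; have n0 : (0 < n)%N by apply: leq_trans n13.
have hold p : prime p -> (p %| A n)%Z -> exists2 i, (0 < i < n)%N & (p %| A i)%Z.
  move=> p_pr pn; apply: contrapT => hi; apply: hno; exists p => //; split => // i hin.
  by apply/negP => pi; apply: hi; exists i.
have hz := zsigmondy_upper R seqABC m_neq0 kE m_cube_free n0 hold.
have [h hh] := numer_height R seqABC.
have S0 i : (0 < S i)%N by apply: part_gt0.
have dbl i := part6_doubling seqABC m_neq0 kE m_cube_free i.
have hn := (hh n n0).1.
have G0 : (0 < part6 m ^ 2)%N by rewrite expn_gt0 part_gt0.
have lnS5 i : (5 <= S i)%N -> lnn R 5 <= lnn R (S i) by apply: lnn_le.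
have upper i : (0 < i)%N -> lnn R (S i) <= i%:R ^+ 2 * h + (lnn R 9 + lnn R (part6 m ^ 2)) / 3.
  move=> i0; rewrite -lerBlDr; apply: (hh i i0).2 => // l.
  have [g [g1 g2 _]] := dbl (2 ^ l * i)%N; exists g; split => //.
    exact: dvdn_gt0 g2.
  exact: dvdn_leq g2.
have upper1 i : (0 < i)%N -> (forall l p, prime p -> (4 < p)%N -> (p %| A (2 ^ l * i)%N)%Z ->
    ~~ (p %| m)%Z) -> lnn R (S i) <= i%:R ^+ 2 * h + lnn R 9 / 3.
  move=> i0 hl; have l1 : lnn R 1 = 0 by rewrite /lnn ln1.
  have := (hh i i0).2 1%N isT; rewrite l1 addr0 lerBlDr; apply => l.
  have [g [g1 _ g3]] := dbl (2 ^ l * i)%N; exists 1%N; split => //.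
  by move: g1; rewrite (g3 (hl l)).
have [[p [p_pr p4 pm p1]]|nonsing] := pselect (exists p, [/\ prime p, (4 < p)%N, (p %| m)%Z & (p %| A 1)%Z]).
  have pm6 : (p %| part6 m)%N.
    rewrite -[p]expn1 pfactor_dvdn ?part_gt0 // logn_partn // -pfactor_dvdn ?absz_gt0 //.
  have G5 : (5 <= part6 m)%N.
    by apply: part6_ge5 => //; apply: contraTneq pm6 => ->; rewrite Euclid_dvd1.
  have GS := part6_numer_lower seqABC m_neq0 kE m_cube_free (isT : (0 < 3)%N).
  have S3 : (5 <= S 3)%N.
    apply: part6_ge5; first by rewrite lt0r_neq0 // (mseq_A_gt0 seqABC).
    apply: contraTneq GS => ->; rewrite -ltnNge; apply: (@leq_trans (5 ^ 2)) => //.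
    by rewrite leq_exp2r.
  (* The multiples 2^l * 3 of Q are nonsingular at every p >= 5 dividing m, so their duplications
     lose only the factor 9. The coefficient of h is 3^2. *)
  have h3 : lnn R (S 3) - lnn R 9 / 3 <= 9 * h.
    rewrite lerBlDr (_ : 9 = 3%:R ^+ 2) -?natrX //; rewrite natrX.
    apply: upper1 => // l q q_pr q4 qA; apply: contraL qA => qm.
    rewrite mulnC; apply: (numer_triple_ndvd seqABC q_pr q4 m_neq0 kE) => //.
    - exact: m_cube_free.
    - by rewrite expn_gt0.
    - by rewrite (prime_big_dvd_k kE).
  have [hb hE] := singular_bound G0 S3 GS h3.
  exact: (zsigmondy_contradiction seqABC kE m_cube_free n13 hb hE upper hn hz).
(* Now Q itself, and with it each multiple, is nonsingular at every p >= 5 dividing m. *)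
have nons i l q : prime q -> (4 < q)%N -> (q %| A (2 ^ l * i)%N)%Z -> ~~ (q %| m)%Z.
  move=> q_pr q4 qA; apply/negP => qm; apply: nonsing; exists q; split => //.
  apply/negPn/negP => q1.
  have qk : (q %| k)%Z by rewrite (prime_big_dvd_k kE).
  by move: (singular_closed seqABC q_pr (2 ^ l * i) qk q1); rewrite muln1 qA.
have upper2 i : (0 < i)%N -> lnn R (S i) <= i%:R ^+ 2 * h + lnn R 9 / 3.
  by move=> i0; apply: upper1 => // l q; apply: nons.
have h95 : lnn R 9 / 3 < lnn R 5.
  have : lnn R 9 < lnn R (5 ^ 3) by rewrite /lnn ltr_ln ?posrE ?ltr0n ?ltr_nat.
  by rewrite lnnX //; lra.
have [h0 h5] : 0 <= h /\ lnn R 5 - lnn R 9 / 3 <= 4 * h.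
  case: (numer1_large_or_2 seqABC m_neq0 kE m_cube_free) => /lnS5 hS.
    have := upper2 1%N isT; rewrite expr1n mul1r => hu; split; lra.
  have := upper2 2%N isT; rewrite -natrX => hu; split; lra.
have [hb hE] := nonsingular_bound h0 h5.
exact: (zsigmondy_contradiction seqABC kE m_cube_free n13 hb hE upper2 hn hz).
Qed.

End PrimitiveDivisor.

(** * From the multiples of Q to the Zsigmondy bound *)

Lemma mordell_seq_multiples (m : int) (Q : ecpoint rat) (A B C : nat -> int) :
  m != 0 -> oncurve 0 (mordell_b m) Q -> nontorsion 0 Q ->
  (forall n : nat, (0 < n)%N ->
       [/\ B n != 0,
           ecmul 0 n Q = ECAff ((A n)%:Q / (B n)%:Q ^+ 2)
                               ((C n)%:Q / (B n)%:Q ^+ 3),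
           coprimez (A n) (B n) & coprimez (C n) (B n)]) ->
  mordell_seq (432 * m ^+ 2) (fun n => if n is 0%N then 1 else A n)
    (fun n => if n is 0%N then 0 else B n) (fun n => if n is 0%N then 1 else C n).
Proof.
move=> m0 Qm Qnt nQ; have k0 : 0 < 432 * m ^+ 2 by rewrite mulr_gt0 // exprn_even_gt0.
have kr0 : 0 < (432 * m ^+ 2)%:~R :> rat by rewrite ltr0z.
have Qk : oncurve 0 (- (432 * m ^+ 2)%:~R) Q.
  by move: Qm; rewrite /mordell_b rmorphM rmorphXn /=.
have coord n : (0 < n)%N -> [/\ (B n)%:~R != 0 :> rat,
    ((C n)%:~R / (B n)%:~R ^+ 3) ^+ 2 = ((A n)%:~R / (B n)%:~R ^+ 2) ^+ 3 - (432 * m ^+ 2)%:~R :> rat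
    & 0 < (A n)%:~R / (B n)%:~R ^+ 2 :> rat].
  move=> n0; have [b0 E _ _] := nQ n n0; have [x [y [E' Ey x0]]] := ecmul_affine kr0 Qk Qnt n0.
  by move: E' Ey x0; rewrite E => -[<- <-] Ey x0; rewrite intr_eq0.
split=> //.
- case=> // n; have [b0 _ xp] := coord n.+1 isT.
  by move: xp; rewrite pmulr_lgt0 ?ltr0z // invr_gt0 exprn_even_gt0 //= b0.
- by case=> // n _; have [b0 _ _ _] := nQ n.+1 isT.
- case=> [|n]; first by [].
  by have [_ _ co _] := nQ n.+1 isT.
- case=> [|n]; first by rewrite expr1n expr1n expr0n /= mulr0 addr0.
  have [b0 E _] := coord n.+1 isT; apply: (@intr_inj rat).
  rewrite [in RHS]rmorphD [in RHS]rmorphM !rmorphXn /=.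
  move: E => /(congr1 (fun x => x * (B n.+1)%:~R ^+ 6)).
  move: ((432 * m ^+ 2)%:~R : rat) => k E.
  transitivity (((A n.+1)%:~R / (B n.+1)%:~R ^+ 2) ^+ 3 * (B n.+1)%:~R ^+ 6 : rat).
    by field.
  by move: E; rewrite mulrBl => /(canLR (subrK _)) <-; congr (_ + _); field.
move=> i j ji; have xE n : xinv Q n = abscissa_inv (fun n => if n is 0%N then 1 else A n)
    (fun n => if n is 0%N then 0 else B n) n.
  case: n => [|n]; first by rewrite /abscissa_inv expr0n mul0r.
  by have [_ E _ _] := nQ n.+1 isT; rewrite /xinv E invf_div.
by have := xinv_law kr0 Qk Qnt ji; rewrite /xlaw !xE.
Qed.

Unset Implicit Arguments.

Theorem theorem2p3 (m : int) (Q : ecpoint rat) (A B C : nat -> int)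
    (m_neq0 : m != 0)
    (m_cube_free : cube_free m)
    (Q_oncurve : oncurve 0 (mordell_b m) Q)
    (Q_nontorsion : nontorsion 0 Q)
    (nQ_eq : forall n : nat, (0 < n)%N ->
       [/\ B n != 0,
           ecmul 0 n Q = ECAff ((A n)%:Q / (B n)%:Q ^+ 2)
                               ((C n)%:Q / (B n)%:Q ^+ 3),
           coprimez (A n) (B n) & coprimez (C n) (B n)]) :
  (zsigmondy_bound A <= 12%:E)%E.
Proof.
have seqABC := mordell_seq_multiples m_neq0 Q_oncurve Q_nontorsion nQ_eq.
have cf p : prime p -> ~~ (p%:Z ^+ 3 %| m)%Z.
  move=> p_pr; apply/negP => /m_cube_free; rewrite ger0_norm // => -[p1].
  by move: p_pr; rewrite p1.
have small n : no_primitive_divisor A n -> (n <= 12)%N.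
  move=> [n0 np]; rewrite leqNgt; apply/negP => n13; apply: np.
  have [p p_pr [pn pnew]] := ex_new_prime seqABC m_neq0 erefl cf Rdefinitions.R n13.
  (* [seqABC] concerns the sequence altered at index 0; destructing the indices identifies its
     positive terms with those of [A]. *)
  case: n n0 n13 pn pnew => // n _ n13 pn pnew.
  exists p%:Z; split => //; first by rewrite ltz_nat prime_gt1.
  move=> [|i] // /andP[_ lin] _; rewrite coprimezE absz_nat prime_coprime //.
  by have := pnew i.+1 lin.
have fin : finite_set (no_primitive_divisor A).
  by apply: (sub_finite_set _ (finite_II 13)) => n /small; rewrite /= ltnS.
rewrite /zsigmondy_bound asboolT // lee_fin lez_nat.
apply/bigmax_leqP_seq => n; rewrite in_fset_set // inE => /small n12 _.
exact: n12.
Qed.
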